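(* For $R>0$ let $B_R\subset\mathbb R^3$ be the open ball of radius $R$ centered at the origin, with outer unit normal $\nu$. (i) If $R\geq\sqrt3$, then there is no admissible $u\in C^2(\overline{B_R})$ solving $\sigma_2(h_i{}^j)=1$ in $B_R$ with $u_\nu=-au$ on $\partial B_R$ for any $0<a\leq1$, nor with $u_\nu=\lambda$ on $\partial B_R$ for any constant $\lambda$. (ii) If $0<R<\sqrt3$ and $0<a\leq1$, then $$u_{R,a}(x)=-\sqrt{3-|x|^2}+\sqrt{3-R^2}-\frac{R}{a\sqrt{3-R^2}}$$ is a strictly convex solution of $\sigma_2(h_i{}^j)=1$ in $B_R$, $u_\nu=-au$ on $\partial B_R$. The same spherical cap, with an arbitrary constant added, solves $\sigma_2(h_i{}^j)=1$ in $B_R$, $u_\nu=\lambda$ on $\partial B_R$ with $\lambda=R/\sqrt{3-R^2}$; this normal derivative tends to $\infty$ as $R\uparrow\sqrt3$. (iii) Consequently, since $|B_{\sqrt3}|=4\pi\sqrt3$, the constant $4\pi\sqrt3$ in the condition $|\Omega|<4\pi\sqrt3$ is optimal among hypotheses involving only the volume $|\Omega|$ that guarantee solvability for every uniformly convex domain: the endpoint $4\pi\sqrt3$ cannot be increased.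
   Context: For a function $u$ on $\overline\Omega\subset\mathbb R^3$ put $W=(1+|Du|^2)^{1/2}$, $g_{ij}=\delta_{ij}+u_iu_j$, $g^{ij}=\delta_{ij}-u_iu_j/W^2$, $h_{ij}=u_{ij}/W$, $h_i{}^j=g^{jk}h_{ki}$ (summation convention; $u_i,u_{ij}$ are Euclidean partial derivatives). The eigenvalues $\kappa=(\kappa_1,\kappa_2,\kappa_3)$ of $(h_i{}^j)$ are the principal curvatures of the graph of $u$, and $\sigma_k(h_i{}^j)=\sigma_k(\kappa)$ is the $k$-th elementary symmetric function. $\Gamma_2=\{\kappa\in\mathbb R^3:\sigma_1(\kappa)>0,\ \sigma_2(\kappa)>0\}$; $u$ is admissible if $\kappa\in\Gamma_2$ at every point. Solvability refers to existence of an admissible classical solution of the Robin problem ($\sigma_2(h_i{}^j)=1$ in $\Omega$, $u_\nu=-au$ on $\partial\Omega$, $0<a\leq1$) or of the Neumann problem ($\sigma_2(h_i{}^j)=1$ in $\Omega$, $u_\nu=\lambda$ on $\partial\Omega$ for some constant $\lambda$). A bounded domain is uniformly convex if the second fundamental form of its boundary (positive for balls) is bounded below by a positive constant. *)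

(* Defs.v *)
From HB Require Import structures.
From mathcomp Require Import all_boot all_order all_algebra.
From mathcomp Require Import all_classical all_reals all_analysis.
Set Implicit Arguments.
Unset Strict Implicit.
Unset Printing Implicit Defensive.
Import Order.TTheory GRing.Theory Num.Theory.
Import numFieldNormedType.Exports.
Local Open Scope classical_set_scope.
Local Open Scope ring_scope.

(* R^3 is 'rV[R]_3.  The library norm on 'rV[R]_3 is the sup norm; it is only
   used through the topology and boundedness, Euclidean lengths being given by
   dot and enorm. *)

Definition dot (R : realType) (x y : 'rV[R]_3) : R := \sum_i x 0 i * y 0 i.

Definition enorm (R : realType) (x : 'rV[R]_3) : R := Num.sqrt (dot x x).

Definition eball (R : realType) (r : R) : set 'rV[R]_3 := [set x | enorm x < r].

Definition boundary (R : realType) (Om : set 'rV[R]_3) : set 'rV[R]_3 :=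
  closure Om `\` interior Om.

(* Three-dimensional Lebesgue measure, with R^3 read as R * R * R. *)
Definition volume (R : realType) (Om : set 'rV[R]_3) : \bar R :=
  ((@lebesgue_measure R \x @lebesgue_measure R) \x @lebesgue_measure R)%E
    [set p | Om (\row_i [:: p.1.1; p.1.2; p.2]`_i)].

Definition partial (R : realType) (i : 'I_3) (f : 'rV[R]_3 -> R) :
  'rV[R]_3 -> R := fun x => 'D_(delta_mx 0 i) f x.

Definition gradient (R : realType) (f : 'rV[R]_3 -> R) (x : 'rV[R]_3) :
  'rV[R]_3 := \row_i partial i f x.

Definition C2 (R : realType) (U : set 'rV[R]_3) (f : 'rV[R]_3 -> R) : Prop :=
  forall x, U x ->
  [/\ {for x, continuous f},
      forall i, derivable f x (delta_mx 0 i) /\ {for x, continuous (partial i f)}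
    & forall i j, derivable (partial i f) x (delta_mx 0 j) /\
        {for x, continuous (partial j (partial i f))}].

(* f is in C^2(closure Om), for Om open: f is C^2 in Om, and f and its partial
   derivatives of order at most 2 extend continuously to the closure, the
   extension of f being f itself.  Values of f off the closure are irrelevant. *)
Definition C2_closure (R : realType) (Om : set 'rV[R]_3) (f : 'rV[R]_3 -> R) :
    Prop :=
  C2 Om f /\
  forall x, closure Om x ->
  [/\ f @ within Om (nbhs x) --> f x,
      forall i, cvg (partial i f @ within Om (nbhs x))
    & forall i j, cvg (partial j (partial i f) @ within Om (nbhs x))].

(* The continuous extension of f from Om to its closure; at the points of Om
   where f is continuous it is f. *)
Definition extension (R : realType) (Om : set 'rV[R]_3) (f : 'rV[R]_3 -> R)
    (x : 'rV[R]_3) : R :=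
  lim (f @ within Om (nbhs x)).

(* Du and D^2 u on the closure of Om. *)
Definition Du (R : realType) (Om : set 'rV[R]_3) (u : 'rV[R]_3 -> R)
    (x : 'rV[R]_3) : 'rV[R]_3 :=
  \row_i extension Om (partial i u) x.

Definition D2u (R : realType) (Om : set 'rV[R]_3) (u : 'rV[R]_3 -> R)
    (x : 'rV[R]_3) : 'M[R]_3 :=
  \matrix_(i, j) extension Om (partial j (partial i u)) x.

Section Graph.
Variables (R : realType) (Om : set 'rV[R]_3) (u : 'rV[R]_3 -> R).
Variable x : 'rV[R]_3.

Definition gW : R := Num.sqrt (1 + dot (Du Om u x) (Du Om u x)).

Definition g_inv : 'M[R]_3 :=
  \matrix_(i, j) ((i == j)%:R - Du Om u x 0 i * Du Om u x 0 j / gW ^+ 2).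

Definition second_form : 'M[R]_3 := \matrix_(i, j) (D2u Om u x i j / gW).

(* h_i^j, at row i and column j *)
Definition shape : 'M[R]_3 :=
  \matrix_(i, j) \sum_k g_inv j k * second_form k i.

End Graph.

(* The eigenvalues of A with multiplicity, in some order; only symmetric
   functions of them are used.  If the characteristic polynomial does not split
   over R the value is 0, which is not in Gamma2 and has sigma 2 0 = 0. *)
Definition eigenvalues (R : realType) (A : 'M[R]_3) : 'rV[R]_3 :=
  xget 0 [set k : 'rV[R]_3 | char_poly A = \prod_i ('X - (k 0 i)%:P)].

Definition curvatures (R : realType) (Om : set 'rV[R]_3) (u : 'rV[R]_3 -> R)
    (x : 'rV[R]_3) : 'rV[R]_3 :=
  eigenvalues (shape Om u x).

Definition sigma (R : realType) (k : nat) (kappa : 'rV[R]_3) : R :=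
  \sum_(I : {set 'I_3} | #|I| == k) \prod_(i in I) kappa 0 i.

Definition Gamma2 (R : realType) : set 'rV[R]_3 :=
  [set kappa | 0 < sigma 1 kappa /\ 0 < sigma 2 kappa].

Definition admissible (R : realType) (Om : set 'rV[R]_3) (u : 'rV[R]_3 -> R) :
    Prop :=
  forall x, closure Om x -> Gamma2 (curvatures Om u x).

(* rho is a C^2 defining function of Om near the boundary point x. *)
Definition defining_function (R : realType) (Om : set 'rV[R]_3)
    (x : 'rV[R]_3) (rho : 'rV[R]_3 -> R) : Prop :=
  gradient rho x != 0 /\
  exists2 U, open_nbhs x U & C2 U rho /\ forall y, U y -> (Om y <-> rho y < 0).

Definition unit_normal_field (R : realType) (rho : 'rV[R]_3 -> R)
    (y : 'rV[R]_3) : 'rV[R]_3 :=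
  (enorm (gradient rho y))^-1 *: gradient rho y.

(* The outer unit normal of Om at x, which does not depend on the defining
   function. *)
Definition outer_normal (R : realType) (Om : set 'rV[R]_3) (x : 'rV[R]_3) :
    'rV[R]_3 :=
  xget 0 [set nu | exists2 rho, defining_function Om x rho &
                                nu = unit_normal_field rho x].

Definition normal_derivative (R : realType) (Om : set 'rV[R]_3)
    (u : 'rV[R]_3 -> R) (x : 'rV[R]_3) : R :=
  dot (Du Om u x) (outer_normal Om x).

(* <D_xi N, eta> for the outer unit normal field N: with this sign the form of
   a sphere of radius r is 1/r times the metric. *)
Definition boundary_form (R : realType) (rho : 'rV[R]_3 -> R)
    (x xi eta : 'rV[R]_3) : R :=
  dot ('D_xi (unit_normal_field rho) x) eta.

Definition uniformly_convex (R : realType) (Om : set 'rV[R]_3) : Prop :=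
  exists2 c : R, 0 < c &
  forall x, boundary Om x -> exists2 rho, defining_function Om x rho &
    forall xi, dot xi (gradient rho x) = 0 ->
      c * dot xi xi <= boundary_form rho x xi xi.

Definition uniformly_convex_domain (R : realType) (Om : set 'rV[R]_3) : Prop :=
  [/\ Om !=set0, open Om, connected Om, bounded_set Om & uniformly_convex Om].

(* Admissible classical solutions of sigma_2 = 1 in Om. *)
Definition curvature_solution (R : realType) (Om : set 'rV[R]_3)
    (u : 'rV[R]_3 -> R) : Prop :=
  [/\ C2_closure Om u, admissible Om u
    & forall x, Om x -> sigma 2 (curvatures Om u x) = 1].

Definition robin_solution (R : realType) (Om : set 'rV[R]_3) (a : R)
    (u : 'rV[R]_3 -> R) : Prop :=
  curvature_solution Om u /\
  forall x, boundary Om x -> normal_derivative Om u x = - a * u x.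

Definition neumann_solution (R : realType) (Om : set 'rV[R]_3) (lambda : R)
    (u : 'rV[R]_3 -> R) : Prop :=
  curvature_solution Om u /\
  forall x, boundary Om x -> normal_derivative Om u x = lambda.

Definition robin_solvable (R : realType) (a : R) (Om : set 'rV[R]_3) : Prop :=
  exists u, robin_solution Om a u.

Definition neumann_solvable (R : realType) (Om : set 'rV[R]_3) : Prop :=
  exists lambda u, neumann_solution Om lambda u.

(* The hypothesis P on the volume alone guarantees S on every uniformly convex
   domain. *)
Definition volume_guarantees (R : realType) (P : set (\bar R))
    (S : set (set 'rV[R]_3)) : Prop :=
  forall Om, uniformly_convex_domain Om -> P (volume Om) -> S Om.

(* c is optimal as the endpoint of a condition |Om| < c: no volume-only
   hypothesis guaranteeing S admits a volume v >= c; in particular the endpoint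
   of a guaranteeing condition |Om| < c' is at most c. *)
Definition optimal_endpoint (R : realType) (S : set (set 'rV[R]_3)) (c : R) :
    Prop :=
  (forall P, volume_guarantees P S -> forall v : R, 0 < v -> P v%:E -> v < c) /\
  (forall c' : R, volume_guarantees [set v | (v < c'%:E)%E] S -> c' <= c).

Definition strictly_convex_on (R : realType) (A : set 'rV[R]_3)
    (u : 'rV[R]_3 -> R) : Prop :=
  forall x y (t : R), A x -> A y -> x != y -> 0 < t < 1 ->
    u (t *: x + (1 - t) *: y) < t * u x + (1 - t) * u y.

Definition sphere_cap (R : realType) (x : 'rV[R]_3) : R :=
  - Num.sqrt (3 - enorm x ^+ 2).

Definition robin_cap (R : realType) (r a : R) (x : 'rV[R]_3) : R :=
  sphere_cap x + Num.sqrt (3 - r ^+ 2) - r / (a * Num.sqrt (3 - r ^+ 2)).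

(* Main.v *)
Require Import Defs.
From mathcomp Require Import all_boot all_order all_algebra.
From mathcomp Require Import all_classical all_reals all_analysis.
From mathcomp Require Import measurable_realfun ring lra.
Set Implicit Arguments.
Unset Strict Implicit.
Unset Printing Implicit Defensive.
Import Order.TTheory GRing.Theory Num.Theory.
Import numFieldNormedType.Exports.
Local Open Scope classical_set_scope.
Local Open Scope ring_scope.

(* Nonexistence: for a solution [u] on the ball of radius [r >= sqrt 3],
   Maclaurin's inequality [sigma_1 ^ 2 >= 3 sigma_2] makes the mean curvature
   [sigma_1] at least [sqrt 3].  Compare [u] with the lower hemisphere [v] of
   radius [rho > r]: since [Du] is bounded up to the boundary while the slope of
   [v] at the boundary tends to infinity as [rho] decreases to [r], for a
   suitable [rho] the maximum of [u - v] over the closed ball is interior.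
   There [Du = Dv] and [D^2 u <= D^2 v], hence [sigma_1] of [u] is at most the
   mean curvature [3 / rho < sqrt 3] of [v], a contradiction.  Every
   volume [c >= 4 pi sqrt 3] is thus the volume of a ball without solutions. *)

(** * Directional derivatives *)

(** Comparing [sigma 1] instead of [sigma 2] is what makes the touching argument work: it is the
    trace of the shape matrix, hence linear in D^2 u with coefficients that depend on Du alone and
    form a positive definite matrix, so at a point where Du = Dv the order of the Hessians passes to
    the traces. The contradiction comes from the equation and the bound on Du, so a single theorem
    excludes Robin and Neumann solutions together. The comparison radius rho must exceed r for two
    reasons: v has to be C^2 up to the boundary, and 3 / rho < sqrt 3 has to be strict even when r =
    sqrt 3. Since [C2] speaks of coordinate partial derivatives while the touching argument
    differentiates along every line, directional derivatives must be recovered from continuous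
    partial derivatives. *)

Section Line.
Variables (R : realType) (V : normedModType R).
Implicit Types (f : V -> R) (x v : V).

(** Both sides are limits of the same difference quotient. This bridge brings one-variable calculus
    (mean value theorem, chain rule, tests at a maximum) to functions on R^3. *)
Lemma is_derive_line f x v (t l : R) :
  is_derive (x + t *: v) v f l <-> is_derive t 1 (fun s => f (x + s *: v)) l.
Proof.
pose q h := h^-1 *: (f (h *: v + (x + t *: v)) - f (x + t *: v)).
have E : q = (fun h : R => h^-1 *: (f (x + (h *: 1 + t) *: v) - f (x + t *: v))).
  by apply/funext => h; rewrite /q [h *: 1]mulr1 scalerDl addrCA.
have D : derivable f (x + t *: v) v = derivable (fun s : R => f (x + s *: v)) t 1.
  exact: (congr1 (fun q => cvg (q @ 0^')) E).
have L : 'D_v f (x + t *: v) = 'D_1 (fun s : R => f (x + s *: v)) t.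
  exact: (congr1 (fun q => lim (q @ 0^')) E).
split=> -[d <-].
  by apply: DeriveDef; [rewrite -D|rewrite -L].
by apply: DeriveDef; [rewrite D|rewrite L].
Qed.

Lemma MVT_direction f x v :
  (forall t : R, 0 <= t <= 1 -> derivable f (x + t *: v) v) ->
  exists2 c : R, 0 <= c <= 1 & f (x + v) - f x = 'D_v f (x + c *: v).
Proof.
move=> df.
have dg (t : R) : 0 <= t <= 1 ->
    is_derive t 1 (fun s : R => f (x + s *: v)) ('D_v f (x + t *: v)).
  by move=> t01; apply/is_derive_line/derivableP/df.
have [t||c c01] := @MVT_segment R (fun s : R => f (x + s *: v))
    (fun t => 'D_v f (x + t *: v)) 0 1 ler01.
- by rewrite in_itv/= => /andP[t0 t1]; apply: dg; rewrite !ltW.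
- apply: derivable_within_continuous => t; rewrite in_itv/= => t01.
  by have [] := dg _ t01.
rewrite scale1r scale0r addr0 subr0 mulr1 => E.
by exists c.
Qed.

Lemma is_derive_scale_direction f x v (a l : R) :
  is_derive x v f l -> is_derive x (a *: v) f (a * l).
Proof.
move=> df; rewrite -[x]addr0 -[0](scale0r (a *: v)); apply/is_derive_line.
pose g (s : R) := f (x + s *: v).
have -> : (fun s : R => f (x + s *: (a *: v))) = g \o (a \*: @id R).
  by apply/funext => s; rewrite /g /= scalerA mulrC.
have dg : is_derive ((a \*: @id R) 0) 1 g l.
  by rewrite /= scaler0; apply/is_derive_line; rewrite scale0r addr0.
have di : is_derive 0 (1 : R) (a \*: @id R) a.
  by apply: is_derive_eq; exact: mulr1.
by rewrite mulrC; apply: (is_derive1_comp dg di).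
Qed.

End Line.

Section Directional.
Variables (R : realType) (n : nat).
Implicit Types (f : 'rV[R]_n -> R) (x v : 'rV[R]_n).

Let trunc v (k : nat) : 'rV[R]_n := \row_j (if (j < k)%N then v 0 j else 0).

Let truncS v (i : 'I_n) : trunc v i.+1 = trunc v i + v 0 i *: delta_mx 0 i.
Proof.
apply/rowP => j; rewrite !mxE /= ltnS leq_eqVlt -val_eqE/=.
case: eqP => [/val_inj ->|_]/=; first by rewrite ltnn add0r mulr1.
by rewrite mulr0 addr0.
Qed.

(** Each point of the axis-parallel path from 0 to v has coordinates bounded by those of v. In the
    sup norm the path therefore never leaves the ball of radius |v|, and all intermediate points of
    the mean value steps stay close to x. *)
Let norm_trunc v (i : 'I_n) (c : R) : 0 <= c <= 1 ->
  `|trunc v i + (c * v 0 i) *: delta_mx 0 i| <= `|v|.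
Proof.
move=> /andP[c0 c1]; rewrite {1}/Num.Def.normr/= mx_normrE.
apply: bigmax_le => //= -[a j] _ /=; rewrite !mxE ord1 /=.
have vj : `|v 0 j| <= `|v|.
  by rewrite /Num.Def.normr/= mx_normrE; exact: (le_bigmax _ _ (0, j)).
have [->|ij] := eqVneq i j.
  rewrite ltnn add0r mulr1 normrM (ger0_norm c0).
  by apply: le_trans vj; exact: ler_piMl.
rewrite ?(eq_sym j) ?(negPf ij) ?andbF mulr0 addr0; case: ifP => // _.
by rewrite normr0.
Qed.

(* Telescoping over the coordinates: each step is one use of the mean value
   theorem along a coordinate axis. *)
Lemma is_derive_direction f x v :
  (\forall y \near x, forall i, derivable f y (delta_mx 0 i)) ->
  (forall i, {for x, continuous (fun y => 'D_(delta_mx 0 i) f y)}) ->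
  is_derive x v f (\sum_i v 0 i * 'D_(delta_mx 0 i) f x).
Proof.
move=> df cf.
suff L : h^-1 *: (f (h *: v + x) - f x) @[h --> (0:R)^'] -->
    \sum_i v 0 i * 'D_(delta_mx 0 i) f x.
  by apply: DeriveDef; [apply/cvg_ex; eexists; exact: L|exact: cvg_lim L].
apply/cvgrPdist_le => e e0.
pose S := \sum_i `|v 0 i|; pose e' := e / (S + 1).
have S0 : 0 <= S by rewrite sumr_ge0.
have e'0 : 0 < e' by rewrite divr_gt0// ltr_wpDl.
have : \forall y \near x, forall i, derivable f y (delta_mx 0 i) /\
    `|'D_(delta_mx 0 i) f x - 'D_(delta_mx 0 i) f y| <= e'.
  near=> y => i; split; first by move: i; near: y.
  move: i; near: y; apply: filter_forall => i.
  exact: (cvgrPdist_le _ _).1 (cf i) _ e'0.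
move=> /nbhs_ballP[d /= d0 xd].
near=> h.
have h0 : h != 0 by near: h; exact: nbhs_dnbhs_neq.
have hd : `|h| * `|v| < d.
  rewrite (le_lt_trans (ler_wpM2l _ (_ : _ <= `|v| + 1)))// ?lerDl//.
  rewrite -ltr_pdivlMr ?ltr_wpDl//; near: h; apply: dnbhs0_lt.
  by rewrite divr_gt0// ltr_wpDl.
have bd (i : 'I_n) (c : R) : 0 <= c <= 1 -> forall j,
   let y := (x + h *: trunc v i) + c *: ((h * v 0 i) *: delta_mx 0 i) in
   derivable f y (delta_mx 0 j) /\
    `|'D_(delta_mx 0 j) f x - 'D_(delta_mx 0 j) f y| <= e'.
  move=> c01 j y; apply: xd; rewrite -ball_normE /ball_ /= /y.
  rewrite -addrA opprD addrA subrr sub0r normrN.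
  rewrite scalerA mulrCA -scalerA -scalerDr normrZ.
  by apply: le_lt_trans hd; apply: ler_wpM2l => //; exact: norm_trunc.
have step (i : 'I_n) : exists2 w : R, `|'D_(delta_mx 0 i) f x - w| <= e' &
    f (x + h *: trunc v i.+1) - f (x + h *: trunc v i) = h * (v 0 i * w).
  have [t t01|c c01] := @MVT_direction R _ f (x + h *: trunc v i)
     ((h * v 0 i) *: delta_mx 0 i).
    have [d1 _] := bd i t t01 i.
    by have [] := is_derive_scale_direction (h * v 0 i) (derivableP d1).
  have [d1 d2] := bd i c c01 i.
  have [_ ->] := is_derive_scale_direction (h * v 0 i) (derivableP d1) => Ef.
  eexists; first exact: d2.
  by rewrite truncS scalerDr addrA scalerA Ef mulrA.
have {step} /choice[w wP] : forall i, exists w : R, `|'D_(delta_mx 0 i) f x - w| <= e' /\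
    f (x + h *: trunc v i.+1) - f (x + h *: trunc v i) = h * (v 0 i * w).
  by move=> i; have [w] := step i; exists w.
have -> : f (h *: v + x) - f x = h * \sum_i v 0 i * w i.
  rewrite mulr_sumr.
  transitivity (\sum_(i < n) (f (x + h *: trunc v i.+1) - f (x + h *: trunc v i))).
    rewrite -(big_mkord xpredT (fun i =>
      f (x + h *: trunc v i.+1) - f (x + h *: trunc v i))).
    rewrite (telescope_sumr (fun i => f (x + h *: trunc v i)))//.
    have -> : trunc v n = v by apply/rowP => j; rewrite mxE ltn_ord.
    have -> : trunc v 0 = 0 by apply/rowP => j; rewrite !mxE.
    by rewrite scaler0 addr0 [h *: v + x]addrC.
  by apply: eq_bigr => i _; have [] := wP i.
rewrite scalerA mulVf// scale1r -sumrB.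
rewrite (le_trans (ler_norm_sum _ _ _))//.
rewrite (@le_trans _ _ (S * e'))//; last first.
  rewrite /e' mulrA ler_pdivrMr ?ltr_wpDl// mulrC ler_wpM2l ?ltW//.
  by rewrite ltrDl.
rewrite mulr_suml ler_sum// => i _; rewrite -mulrBr normrM ler_wpM2l//.
by have [] := wP i.
Unshelve. all: by end_near. Qed.

End Directional.

Lemma is_derive_at_max (R : realType) (phi dphi : R -> R) :
  (\forall t \near (0 : R), is_derive (t : R) 1 phi (dphi t)) ->
  (\forall t \near (0 : R), phi t <= phi 0) -> dphi 0 = 0.
Proof.
move=> dphiE phimax.
have /nbhs_ballP[r /= r0 rP] : \forall t \near (0 : R),
    is_derive (t : R) 1 phi (dphi t) /\ phi t <= phi 0.
  by near=> t; split; near: t.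
have {}rP t : t \in `]-r, r[%R -> is_derive t 1 phi (dphi t) /\ phi t <= phi 0.
  rewrite in_itv/= => /andP[rt tr]; apply: rP.
  by rewrite /ball/= sub0r normrN ltr_norml rt.
have zr : 0 \in `]-r, r[%R by rewrite in_itv/= oppr_lt0 r0.
have [_ <-] := (rP _ zr).1.
apply: (@derive_val _ _ _ _ _ _ _ (@derive1_at_max R phi (- r) r 0 _ _ zr _)).
- by rewrite ge0_cp// ltW.
- by move=> t /rP[[]].
- by move=> t /rP[].
Unshelve. all: by end_near. Qed.

(** If q were positive, then [dphi 0 = 0] would make [dphi] positive just to the right of 0, and the
    mean value theorem would push [phi] above its maximum. Only the derivative of [dphi] at 0
    enters. *)
Lemma second_derivative_le0_at_max (R : realType) (phi dphi : R -> R) (q : R) :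
  (\forall t \near (0 : R), is_derive (t : R) 1 phi (dphi t)) ->
  is_derive (0 : R) 1 dphi q -> (\forall t \near (0 : R), phi t <= phi 0) -> q <= 0.
Proof.
move=> dphiE ddphi phimax.
have dphi0 := is_derive_at_max dphiE phimax.
have {phimax}/nbhs_ballP[r /= r0 rP] : \forall t \near (0 : R),
    is_derive (t : R) 1 phi (dphi t) /\ phi t <= phi 0.
  by near=> t; split; near: t.
have {}rP t : t \in `]-r, r[%R -> is_derive t 1 phi (dphi t) /\ phi t <= phi 0.
  rewrite in_itv/= => /andP[rt tr]; apply: rP.
  by rewrite /ball/= sub0r normrN ltr_norml rt.
rewrite leNgt; apply/negP => q0.
have [dd dE] := ddphi.
have /cvgrPdist_lt/(_ _ q0) : h^-1 *: (dphi (h *: 1 + 0) - dphi 0) @[h --> (0:R)^'] --> q.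
  by rewrite -dE; exact: dd.
move=> /nbhs_ballP[e /= e0 eP].
pose b := Num.min (r / 2) (e / 2).
have b0 : 0 < b by rewrite lt_min !divr_gt0.
have br : b < r by rewrite gt_min ltr_pdivrMr// ltr_pMr// ltr1n.
have be : b < e.
  by rewrite gt_min [X in _ || X]ltr_pdivrMr// [X in _ || X]ltr_pMr// ltr1n orbT.
have dpos c : c \in `]0, b[%R -> 0 < dphi c.
  rewrite in_itv/= => /andP[c0 cb].
  have := eP c; rewrite /ball/= sub0r normrN gtr0_norm// (lt_trans cb be).
  move=> /(_ isT); rewrite gt_eqF// => /(_ isT).
  rewrite dphi0 subr0 addr0 [c *: 1]mulr1 => H.
  have : 0 < c^-1 * dphi c.
    move: (H : `|q - c^-1 * dphi c| < q); rewrite ltr_norml => /andP[_].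
    by rewrite ltrBlDr ltrDl.
  by rewrite pmulr_rgt0// invr_gt0.
have [t|t|c cb E] := @MVT R phi dphi 0 b b0.
  rewrite in_itv/= => /andP[t0 tb]; apply: (rP _ _).1.
  by rewrite in_itv/= (lt_trans _ t0) ?oppr_lt0// (lt_trans tb).
- apply: derivable_within_continuous => {}t; rewrite in_itv/= => /andP[t0 tb].
  have [|[]//] := rP t; rewrite in_itv/= (lt_le_trans _ t0) ?oppr_lt0//.
  by rewrite (le_lt_trans tb).
- have [|_] := rP b; first by rewrite in_itv/= br (lt_trans _ b0)// oppr_lt0.
  by rewrite leNgt -subr_gt0 E subr0 mulr_gt0// dpos.
Unshelve. all: by end_near. Qed.

(** * Euclidean balls *)

Section Euclidean.
Variable R : realType.
Implicit Types (x y v : 'rV[R]_3) (r : R).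

Lemma dotE x y : dot x y = x 0 0 * y 0 0 + x 0 1 * y 0 1 + x 0 2%:R * y 0 2%:R.
Proof.
rewrite /dot !big_ord_recl big_ord0 addr0 addrA.
by do ![congr (_ + _)|congr (_ * _)|congr (_ 0 _)|exact/val_inj].
Qed.

Lemma dot_ge0 x : 0 <= dot x x.
Proof. by apply: sumr_ge0 => i _; rewrite -expr2 sqr_ge0. Qed.

Lemma dotC x y : dot x y = dot y x.
Proof. by apply: eq_bigr => i _; rewrite mulrC. Qed.

Lemma dotDl x y v : dot (x + y) v = dot x v + dot y v.
Proof. by rewrite /dot -big_split; apply: eq_bigr => i _; rewrite mxE mulrDl. Qed.

Lemma dotZl a x y : dot (a *: x) y = a * dot x y.
Proof. by rewrite /dot mulr_sumr; apply: eq_bigr => i _; rewrite mxE mulrA. Qed.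

Lemma dotDr x y v : dot v (x + y) = dot v x + dot v y.
Proof. by rewrite dotC dotDl !(dotC v). Qed.

Lemma dotZr a x y : dot x (a *: y) = a * dot x y.
Proof. by rewrite dotC dotZl dotC. Qed.

Lemma dot0 x : dot 0 x = 0.
Proof. by rewrite -(scale0r 0) dotZl mul0r. Qed.

Lemma dot_eq0 x : (dot x x == 0) = (x == 0).
Proof.
apply/eqP/eqP => [|->]; last by rewrite dot0.
move/eqP; rewrite psumr_eq0 => [/allP x0|i _]; last by rewrite -expr2 sqr_ge0.
apply/rowP => i; have := x0 i; rewrite mem_index_enum mxE => /(_ isT).
by rewrite mulf_eq0 orbb => /eqP.
Qed.

Lemma sqr_enorm x : enorm x ^+ 2 = dot x x.
Proof. by rewrite sqr_sqrtr// dot_ge0. Qed.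

Lemma enorm_ge0 x : 0 <= enorm x.
Proof. exact: sqrtr_ge0. Qed.

Lemma enormZ a x : enorm (a *: x) = `|a| * enorm x.
Proof. by rewrite /enorm dotZl dotZr mulrA -expr2 sqrtrM ?sqr_ge0// sqrtr_sqr. Qed.

Lemma enorm0 : enorm (0 : 'rV[R]_3) = 0.
Proof. by rewrite /enorm dot0 sqrtr0. Qed.

Lemma enorm_lt r x : 0 <= r -> (enorm x < r) = (dot x x < r ^+ 2).
Proof.
move=> r0; rewrite -sqr_enorm ltr_pXn2r ?nnegrE ?enorm_ge0//.
Qed.

Lemma enorm_le r x : 0 <= r -> (enorm x <= r) = (dot x x <= r ^+ 2).
Proof.
move=> r0; rewrite -sqr_enorm ler_pXn2r ?nnegrE ?enorm_ge0//.
Qed.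

Lemma normr_coord_le x i : `|x 0 i| <= enorm x.
Proof.
rewrite -(sqrtr_sqr (x 0 i)) ler_wsqrtr// /dot (bigD1 i)//= expr2 lerDl.
by apply: sumr_ge0 => j _; rewrite -expr2 sqr_ge0.
Qed.

Lemma mx_norm_le_enorm x : `|x| <= enorm x.
Proof.
rewrite {1}/Num.Def.normr/= mx_normrE; apply: bigmax_le => [|[i j] _].
  exact: enorm_ge0.
by rewrite /= ord1 normr_coord_le.
Qed.

Lemma continuous_dot : continuous (fun x : 'rV[R]_3 => dot x x).
Proof.
move=> x; under eq_fun do rewrite dotE.
have c (i : 'I_3) : (y : 'rV[R]_3) 0 i * y 0 i @[y --> x] --> x 0 i * x 0 i.
  have c1 := @coord_continuous R 1 3 0 i x.
  exact: (cvgM c1 c1).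
exact: (cvgD (cvgD (c 0) (c 1)) (c 2%:R)).
Qed.

Lemma continuous_enorm : continuous (@enorm R).
Proof.
move=> x; apply: (@continuous_comp _ _ _ (fun x : 'rV[R]_3 => dot x x) Num.sqrt).
  exact: continuous_dot.
exact: sqrt_continuous.
Qed.

Lemma open_eball r : open (eball r : set 'rV[R]_3).
Proof.
apply: (@open_comp _ _ (@enorm R) [set t | t < r]) => [x _|]; last exact: open_lt.
exact: continuous_enorm.
Qed.

Lemma closure_eball r : 0 < r -> closure (eball r) = [set x : 'rV[R]_3 | enorm x <= r].
Proof.
move=> r0; apply/seteqP; split.
  have cl : closed [set x : 'rV[R]_3 | enorm x <= r].
    have /continuous_closedP/(_ _ (@closed_le _ r)) := continuous_enorm.
    exact.
  rewrite ((closure_id _).1 cl).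
  by apply: closureS => x /= /ltW.
move=> x /= xr B xB.
(* A point of the closed ball is approached radially, by t x with t < 1. *)
have : \forall t \near (1 : R)^'-, B (t *: x).
  have : t *: x @[t --> (1 : R)] --> x.
    by rewrite -[X in _ --> X]scale1r; apply: cvgZr_tmp; exact: cvg_id.
  by move=> /(_ _ xB)/= Bt; apply: cvg_within; exact: Bt.
move=> Bt; have : \forall t \near (1 : R)^'-, (eball r `&` B) (t *: x).
  near=> t; split; last by near: t.
  have t0 : 0 < t by near: t; apply: nbhs_left_gt; exact: ltr01.
  have t1 : t < 1 by near: t; exact: nbhs_left_lt.
  rewrite /eball/= enormZ gtr0_norm//.
  have [->|x0] := eqVneq (enorm x) 0; first by rewrite mulr0.
  by rewrite (lt_le_trans _ xr)// gtr_pMl// lt_def x0 enorm_ge0.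
move=> /filter_ex[t [? ?]]; by exists (t *: x).
Unshelve. all: by end_near. Qed.

Lemma boundary_eball r : 0 < r -> boundary (eball r) = [set x : 'rV[R]_3 | enorm x = r].
Proof.
move=> r0; rewrite /boundary closure_eball//.
rewrite ((interior_id _).1 (@open_eball r)).
apply/seteqP; split => x /=; rewrite /eball/=.
  by move=> [xr /negP]; rewrite -leNgt => rx; apply/eqP; rewrite eq_le xr.
by move=> ->; rewrite lexx ltxx.
Qed.

Lemma bounded_eball r : bounded_set (eball r : set 'rV[R]_3).
Proof.
exists r; split; first exact: num_real.
by move=> M rM x /ltW xr /=; rewrite (le_trans _ (ltW rM))// (le_trans (mx_norm_le_enorm x)).
Qed.

Lemma compact_closure_eball r : 0 < r -> compact (closure (eball r : set 'rV[R]_3)).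
Proof.
move=> r0; apply: bounded_closed_compact; last exact: closed_closure.
rewrite closure_eball//; exists r; split; first exact: num_real.
by move=> M rM x xr /=; rewrite (le_trans _ (ltW rM))// (le_trans (mx_norm_le_enorm x)).
Qed.

Lemma connected_eball r : connected (eball r : set 'rV[R]_3).
Proof.
have [r0|r0] := leP r 0.
  rewrite (_ : eball r = set0); first exact: connected0.
  apply/seteqP; split => // x; rewrite /eball/= => xr.
  by have := lt_le_trans xr r0; rewrite ltNge enorm_ge0.
rewrite (_ : eball r = \bigcup_(x in eball r) ((fun t : R => t *: x) @` `[0, 1])).
  apply: bigcup_connected.
    by exists 0 => x _; exists 0; rewrite ?scale0r//= in_itv/= lexx ler01.
  move=> x _; apply: connected_continuous_connected.
    exact: segment_connected.
  apply: continuous_subspaceT => t.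
  by apply: cvgZr_tmp; exact: cvg_id.
apply/seteqP; split => x /=.
  by move=> xr; exists x => //; exists 1; rewrite ?scale1r//= in_itv/= lexx ler01.
move=> [y yr [t]] /=; rewrite in_itv/= => /andP[t0 t1] <-.
rewrite /eball/= enormZ ger0_norm// (le_lt_trans _ yr)// ler_piMl//.
exact: enorm_ge0.
Qed.

End Euclidean.

(** * Spherical caps *)

Section ChainRule.
Variables (R : realType) (V : normedModType R).

Lemma is_derive_comp_direction (f : V -> R) (h : R -> R) (x v : V) (l k : R) :
  is_derive x v f l -> is_derive (f x) 1 h k -> is_derive x v (h \o f) (k * l).
Proof.
move=> df dh; rewrite -[x]addr0 -(scale0r v).
apply: (is_derive_line (h \o f) x v 0 (k * l)).2.
apply: (@is_derive1_comp R h (fun s : R => f (x + s *: v))).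
  by rewrite scale0r addr0.
by apply: (is_derive_line f x v 0 l).1; rewrite scale0r addr0.
Qed.

End ChainRule.

(** The closed formulas for the derivatives of [cap] hold only where [dot x x < q], so their
    continuity is transferred through equality near the point. *)
Lemma near_eq_continuous (T U : topologicalType) (f g : T -> U) (x : T) :
  (\forall y \near x, f y = g y) -> {for x, continuous f} -> {for x, continuous g}.
Proof.
move=> fg cf; rewrite /prop_for /continuous_at -(nbhs_singleton fg).
exact: (cvg_trans (near_eq_cvg fg) cf).
Qed.

Section SphericalCap.
Variable R : realType.
Implicit Types (x y v : 'rV[R]_3).

Lemma is_derive_coord x v (i : 'I_3) :
  is_derive x v (fun y : 'rV[R]_3 => y 0 i) (v 0 i).
Proof.
rewrite -[x]addr0 -(scale0r v).
apply: (is_derive_line (fun y : 'rV[R]_3 => y 0 i) x v 0 (v 0 i)).2.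
rewrite (_ : (fun s : R => _) = cst (x 0 i) + v 0 i \*: @id R).
  by apply: is_derive_eq; rewrite add0r; exact: mulr1.
by apply/funext => s; rewrite !mxE mulrC.
Qed.

Lemma is_derive_dot x v :
  is_derive x v (fun y : 'rV[R]_3 => dot y y) (2 * dot x v).
Proof.
have -> : (fun y : 'rV[R]_3 => dot y y) =
  \sum_i ((fun y : 'rV[R]_3 => y 0 i) * (fun y : 'rV[R]_3 => y 0 i)).
  by apply/funext => y; rewrite fct_sumE.
have dc i := is_derive_coord x v i.
apply: is_derive_eq.
rewrite mulr_sumr; apply: eq_bigr => i _.
by rewrite mulr_natl.
Qed.

(* Beware that q is the square of the radius of the sphere. *)
Definition cap (q c : R) x : R := c - Num.sqrt (q - dot x x).

Variables q c : R.

Definition height x : R := Num.sqrt (q - dot x x).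

Lemma height_gt0 x : dot x x < q -> 0 < height x.
Proof. by move=> xq; rewrite sqrtr_gt0 subr_gt0. Qed.

Lemma sqr_height x : dot x x <= q -> height x ^+ 2 = q - dot x x.
Proof. by move=> xq; rewrite sqr_sqrtr// subr_ge0. Qed.

Lemma is_derive_height x v : dot x x < q ->
  is_derive x v height (- (dot x v / height x)).
Proof.
move=> xq; have h0 := height_gt0 xq.
have dd := is_derive_dot x v.
have d1 : is_derive x v (cst q - (fun y : 'rV[R]_3 => dot y y)) (- (2 * dot x v)).
  by apply: is_derive_eq; rewrite sub0r.
have q0 : 0 < (cst q - (fun y : 'rV[R]_3 => dot y y)) x by rewrite /= subr_gt0.
have := is_derive_comp_direction d1 (is_derive1_sqrt q0).
move=> /is_derive_eq; apply; rewrite -[Num.sqrt _]/(height x).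
by field; rewrite gt_eqF.
Qed.

Lemma is_derive_cap x v : dot x x < q ->
  is_derive x v (cap q c) (dot x v / height x).
Proof.
move=> xq; have dh := is_derive_height v xq.
have : is_derive x v (cst c - height) (dot x v / height x).
  by apply: is_derive_eq; rewrite sub0r opprK.
by [].
Qed.

(** The function differentiated here is the i-th partial derivative of [cap], so this computes its
    Hessian. *)
Lemma is_derive_normal x v (i : 'I_3) : dot x x < q ->
  is_derive x v (fun y : 'rV[R]_3 => y 0 i / height y)
    (v 0 i / height x + x 0 i * dot x v / height x ^+ 3).
Proof.
move=> xq; have dh := is_derive_height v xq; have dc := is_derive_coord x v i.
have h0 := height_gt0 xq.
have dV : is_derive x v (fun y => (height y)^-1) (dot x v / height x ^+ 3).
  have [d1 d2] := dh; have hn0 : height x != 0 by rewrite gt_eqF.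
  apply: DeriveDef; first exact: derivableV.
  rewrite (deriveV hn0 d1) d2 [LHS]mulrN mulNr opprK.
  by field.
have : is_derive x v ((fun y => y 0 i) * (fun y => (height y)^-1))
    (v 0 i / height x + x 0 i * dot x v / height x ^+ 3).
  apply: is_derive_eq; rewrite /= addrC; congr (_ + _); first exact: mulrC.
  by rewrite -mulrA.
by [].
Qed.

Lemma continuous_height : continuous height.
Proof.
move=> x; apply: (@continuous_comp _ _ _ (fun x => q - dot x x) Num.sqrt).
  exact: (cvgB (cvg_cst q) (@continuous_dot R x)).
exact: sqrt_continuous.
Qed.

Lemma near_dot_lt x : dot x x < q -> \forall y \near x, dot y y < q.
Proof.
by move=> xq; have /cvgr_lt := @continuous_dot R x; apply.
Qed.

Lemma dot_delta x (i : 'I_3) : dot x (delta_mx 0 i) = x 0 i.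
Proof.
rewrite /dot (bigD1 i)//= big1 => [|j ji].
  by rewrite mxE !eqxx mulr1 addr0.
by rewrite mxE (negPf ji) andbF mulr0.
Qed.

Lemma partial_cap x (i : 'I_3) : dot x x < q -> partial i (cap q c) x = x 0 i / height x.
Proof.
move=> xq; rewrite /partial; have [_ ->] := is_derive_cap (delta_mx 0 i) xq.
by rewrite dot_delta.
Qed.

Lemma is_derive_partial_cap x v (i : 'I_3) : dot x x < q ->
  is_derive x v (partial i (cap q c))
    (v 0 i / height x + x 0 i * dot x v / height x ^+ 3).
Proof.
move=> xq; apply: near_eq_is_derive (is_derive_normal v i xq).
by apply: filterS (near_dot_lt xq) => y yq; rewrite partial_cap.
Qed.

Lemma partial2_cap x (i j : 'I_3) : dot x x < q ->
  partial j (partial i (cap q c)) x =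
  (i == j)%:R / height x + x 0 i * x 0 j / height x ^+ 3.
Proof.
move=> xq; rewrite {1}/partial; have [_ ->] := is_derive_partial_cap (delta_mx 0 j) i xq.
by rewrite mxE eqxx/= dot_delta.
Qed.

Lemma C2_cap : C2 [set x | dot x x < q] (cap q c).
Proof.
move=> x /= xq.
have cc (i : 'I_3) := @coord_continuous R 1 3 0 i x.
have ch := @continuous_height x.
have h0 : height x != 0 by rewrite gt_eqF// height_gt0.
split.
- exact: (cvgB (cvg_cst c) ch).
- move=> i; split; first by have [] := is_derive_cap (delta_mx 0 i) xq.
  apply: (@near_eq_continuous _ _ (fun y => y 0 i / height y)).
    by apply: filterS (near_dot_lt xq) => y yq; rewrite partial_cap.
  exact: (cvgM (cc i) (cvgV h0 ch)).
- move=> i j; split; first by have [] := is_derive_partial_cap (delta_mx 0 j) i xq.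
  apply: (@near_eq_continuous _ _ (fun y => (i == j)%:R / height y + y 0 i * y 0 j / height y ^+ 3)).
    by apply: filterS (near_dot_lt xq) => y yq; rewrite partial2_cap.
  have h3 : height x ^+ 3 != 0 by rewrite expf_neq0.
  have ch3 : (fun y => height y ^+ 3) @ x --> height x ^+ 3 by exact: (cvgM ch (cvgM ch ch)).
  exact: (cvgD (cvgM (cvg_cst _) (cvgV h0 ch)) (cvgM (cvgM (cc i) (cc j)) (cvgV h3 ch3))).
Qed.

End SphericalCap.

(** * Symmetric functions of the eigenvalues *)

Section Symmetric.
Variable R : realType.
Implicit Types (k : 'rV[R]_3).

Lemma sigma1E k : sigma 1 k = \sum_i k 0 i.
Proof.
rewrite /sigma (eq_bigl (fun I => I \in [set [set i] | i in 'I_3]%SET)); last first.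
  move=> I; apply/cards1P/imsetP => [[i ->]|[i _ ->]]; by exists i.
rewrite big_imset/=; last by move=> i j _ _; exact: finset.set1_inj.
by apply: eq_bigr => i _; rewrite big_set1.
Qed.

(** In a set of three indices, the two-element subsets are the complements of the singletons. *)
Lemma sigma2E k : sigma 2 k = \sum_i \prod_(j | j != i) k 0 j.
Proof.
rewrite /sigma (eq_bigl (fun I => I \in [set [set~ i] | i in 'I_3]%SET)); last first.
  move=> I; apply/idP/imsetP => [I2|[i _ ->]]; last by rewrite cardsC1 card_ord.
  have /cards1P[i Ei] : #|~: I| == 1%N.
    by rewrite cardsCs finset.setCK (eqP I2) card_ord.
  by exists i => //; rewrite -Ei finset.setCK.
rewrite big_imset/=; last by move=> i j _ _ /finset.setC_inj/finset.set1_inj.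
by apply: eq_bigr => i _; apply: eq_bigl => j; rewrite !inE.
Qed.

Lemma maclaurin k : 3 * sigma 2 k <= sigma 1 k ^+ 2.
Proof.
rewrite sigma1E sigma2E.
under eq_bigr do rewrite big_mkcond.
rewrite !big_ord_recl !big_ord0 /=.
set x := k 0 _; set y := k 0 _; set z := k 0 _.
rewrite -subr_ge0.
rewrite [leRHS](_ : _ = 2^-1 * ((x - y) ^+ 2 + (y - z) ^+ 2 + (z - x) ^+ 2)); last by field.
by rewrite mulr_ge0// !addr_ge0// sqr_ge0.
Qed.

Lemma sigma_const_mx m (c : R) : sigma m (const_mx c) = c ^+ m *+ 'C(3, m).
Proof.
rewrite /sigma (eq_bigr (fun=> c ^+ m)) => [|I /eqP <-]; last first.
  by rewrite -prodr_const; apply: eq_bigr => i _; rewrite mxE.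
by rewrite sumr_const -[in RHS](card_ord 3) -card_draws cardsE.
Qed.

(** Both sides are read off the coefficient of X^2 in the characteristic polynomial, which suits the
    shape matrix, as that matrix is in general not symmetric. *)
Lemma eigenvalues_trace (A : 'M[R]_3) (k : 'rV[R]_3) :
  char_poly A = \prod_i ('X - (k 0 i)%:P) -> \tr A = sigma 1 k.
Proof.
move=> Ak; have := char_poly_trace A isT.
rewrite Ak sigma1E -(big_map (fun i => k 0 i) xpredT (fun z => 'X - z%:P)).
set ks := [seq _ | _ <- _]; have s3 : size ks = 3%N.
  by rewrite size_map -[RHS](size_enum_ord 3) enumT.
have := coefPn_prod_XsubC (ps := ks); rewrite s3 => -> //.
by rewrite big_map => /oppr_inj.
Qed.

(** The choice made by [xget] cannot matter: every coordinate of an eligible vector is a root of (X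
    - c)^3. *)
Lemma eigenvalues_scalar (c : R) : eigenvalues (c%:M : 'M[R]_3) = const_mx c.
Proof.
have cE : char_poly (c%:M : 'M[R]_3) = \prod_(i < 3) ('X - c%:P).
  rewrite char_poly_trig ?scalar_mx_is_trig//.
  by apply: eq_bigr => i _; rewrite mxE eqxx.
rewrite /eigenvalues; case: xgetP => [k _ /= kE|/(_ (const_mx c))]; last first.
  by case; rewrite /= cE; apply: eq_bigr => i _; rewrite mxE.
apply/rowP => i; rewrite mxE.
have : root (\prod_(i < 3) ('X - c%:P)) (k 0 i).
  by rewrite -cE kE /root horner_prod (bigD1 i)//= !hornerE subrr mul0r.
by rewrite /root horner_prod prodf_seq_eq0 => /hasP[j _]; rewrite !hornerE subr_eq0 => /eqP.
Qed.

(** Maclaurin's inequality bounds only the square of [sigma 1]; its positivity, which is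
    admissibility, selects the right root. *)
Lemma sigma2_eigenvalues_trace (A : 'M[R]_3) : sigma 2 (eigenvalues A) = 1 ->
  0 < sigma 1 (eigenvalues A) -> Num.sqrt 3 <= \tr A.
Proof.
rewrite /eigenvalues; case: xgetP => [k _ kE|_]; last first.
  (* Were the characteristic polynomial not split, [eigenvalues] would take its default 0, where
     [sigma 2] is 0 and not 1. *)
  rewrite [X in sigma _ X](_ : _ = const_mx 0)// sigma_const_mx expr0n/= mul0rn.
  by move=> /esym/eqP; rewrite oner_eq0.
rewrite (eigenvalues_trace kE) => s2 s1.
rewrite -(ger0_norm (ltW s1)) -sqrtr_sqr ler_wsqrtr//.
by have := maclaurin k; rewrite s2 mulr1.
Qed.

End Symmetric.

(** * Curvature of spherical caps *)

Section Extension.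
Variable R : realType.
Implicit Types (Om U : set 'rV[R]_3) (f u : 'rV[R]_3 -> R) (x : 'rV[R]_3).

Lemma extension_continuous Om f x : closure Om x -> {for x, continuous f} ->
  extension Om f x = f x.
Proof.
move=> Omx cf; apply: cvg_lim => //.
exact: (cvg_trans (cvg_app _ (@cvg_within _ (nbhs x) _ Om)) cf).
Qed.

Lemma C2_closure_sub Om U f : closure Om `<=` U -> C2 U f -> C2_closure Om f.
Proof.
move=> OmU fU; split=> [x Omx|x Omx].
  by apply/fU/OmU; exact: subset_closure.
have [cf d1 d2] := fU _ (OmU _ Omx).
have within_cvg (g : 'rV[R]_3 -> R) : {for x, continuous g} ->
    g @ within Om (nbhs x) --> g x.
  by move=> cg; exact: (cvg_trans (cvg_app _ (@cvg_within _ (nbhs x) _ Om)) cg).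
split; first exact: within_cvg.
  by move=> i; apply/cvg_ex; eexists; apply: within_cvg; have [] := d1 i.
by move=> i j; apply/cvg_ex; eexists; apply: within_cvg; have [] := d2 i j.
Qed.

Lemma DuE Om U u x : closure Om x -> U x -> C2 U u -> Du Om u x = gradient u x.
Proof.
move=> Omx Ux uU; apply/rowP => i; rewrite !mxE extension_continuous//.
by have [_ /(_ i)[]] := uU _ Ux.
Qed.

Lemma D2uE Om U u x i j : closure Om x -> U x -> C2 U u ->
  D2u Om u x i j = partial j (partial i u) x.
Proof.
move=> Omx Ux uU; rewrite mxE extension_continuous//.
by have [_ _ /(_ i j)[]] := uU _ Ux.
Qed.

End Extension.

Section CapCurvature.
Variables (R : realType) (q c : R) (Om : set 'rV[R]_3).
Hypothesis Omq : closure Om `<=` [set x | dot x x < q].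
Implicit Types x : 'rV[R]_3.

Lemma Du_cap x : closure Om x -> Du Om (cap q c) x = (height q x)^-1 *: x.
Proof.
move=> Omx; have xq := Omq Omx; rewrite (DuE Omx xq (@C2_cap _ q c)).
by apply/rowP => i; rewrite !mxE partial_cap// mulrC.
Qed.

Lemma D2u_cap x (i j : 'I_3) : closure Om x -> D2u Om (cap q c) x i j =
  (i == j)%:R / height q x + x 0 i * x 0 j / height q x ^+ 3.
Proof.
by move=> Omx; have xq := Omq Omx; rewrite (D2uE _ _ Omx xq (@C2_cap _ q c)) partial2_cap.
Qed.

Lemma gW_cap x : closure Om x -> gW Om (cap q c) x = Num.sqrt q / height q x.
Proof.
move=> Omx; have xq := Omq Omx; have h0 := height_gt0 xq.
rewrite /gW Du_cap// dotZl dotZr.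
have -> : 1 + (height q x)^-1 * ((height q x)^-1 * dot x x) = q / height q x ^+ 2.
  rewrite -[X in _ = X / _](subrK (dot x x) q) -sqr_height ?ltW//.
  by field; rewrite gt_eqF.
have q0 : 0 <= q by rewrite ltW// (le_lt_trans _ xq)// dot_ge0.
by rewrite sqrtrM// sqrtrV ?sqr_ge0// sqrtr_sqr gtr0_norm.
Qed.

(** The graph is part of a sphere of radius [Num.sqrt q] in R^4, hence umbilic. *)
Lemma shape_cap x : closure Om x -> Defs.shape Om (cap q c) x = (Num.sqrt q)^-1%:M.
Proof.
move=> Omx; have xq := Omq Omx; have h0 := height_gt0 xq.
have q0 : 0 < q by rewrite (le_lt_trans _ xq)// dot_ge0.
have s0 : 0 < Num.sqrt q by rewrite sqrtr_gt0.
have sE : Num.sqrt q ^+ 2 = q by rewrite sqr_sqrtr// ltW.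
have hE := sqr_height (ltW xq).
apply/matrixP => i j; rewrite !mxE.
set h := height q x in h0 hE *; set s := Num.sqrt q in s0 sE *.
have sum_delta (F : 'I_3 -> R) l : \sum_k (k == l)%:R * F k = F l.
  rewrite (bigD1 l)//= eqxx mul1r big1 ?addr0// => k kl.
  by rewrite (negPf kl) mul0r.
(* [N k] is the entry (k, i) of [second_form], and Du_j Du_k / W^2 reduces to x_j x_k / s^2; the sum
   over k thus splits into a Kronecker part and a rank-one part. *)
pose N k := ((k == i)%:R + x 0 k * x 0 i / h ^+ 2) / s.
transitivity (\sum_k ((k == j)%:R * N k - x 0 j / s ^+ 2 * (x 0 k * N k))).
  apply: eq_bigr => k _; rewrite [g_inv _ _ _ j k]mxE [second_form _ _ _ k i]mxE.
  rewrite gW_cap// Du_cap// D2u_cap// !mxE -/h -/s.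
  rewrite (eq_sym j k) /N; field; by rewrite !gt_eqF.
rewrite sumrB sum_delta -mulr_sumr.
have -> : \sum_k x 0 k * N k = (x 0 i + dot x x * x 0 i / h ^+ 2) / s.
  rewrite -[X in (X + _) / _](sum_delta (fun k => x 0 k)) /dot !mulr_suml -big_split/=.
  by rewrite mulr_suml; apply: eq_bigr => k _; rewrite /N; field; rewrite !gt_eqF.
have -> : dot x x = s ^+ 2 - h ^+ 2 by rewrite sE hE; ring.
rewrite /N (eq_sym j i); case: (i == j) => /=; field; by rewrite !gt_eqF.
Qed.

Lemma curvatures_cap x : closure Om x ->
  curvatures Om (cap q c) x = const_mx (Num.sqrt q)^-1.
Proof. by move=> Omx; rewrite /curvatures shape_cap// eigenvalues_scalar. Qed.

End CapCurvature.

(** * Comparison of C^2 functions *)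

Section C2Calculus.
Variable R : realType.
Implicit Types (U Om : set 'rV[R]_3) (f u v : 'rV[R]_3 -> R) (x xi : 'rV[R]_3).

Lemma C2_is_derive U f x xi : open U -> U x -> C2 U f ->
  is_derive x xi f (\sum_i xi 0 i * partial i f x).
Proof.
move=> oU Ux fU; have [_ d1 _] := fU _ Ux.
apply: is_derive_direction => [|i]; last by have [] := d1 i.
have : \forall y \near x, U y by exact: open_nbhs_nbhs.
by apply: filterS => y /fU[_ d _] i; have [] := d i.
Qed.

Lemma C2_is_derive_partial U f x xi (i : 'I_3) : open U -> U x -> C2 U f ->
  is_derive x xi (partial i f) (\sum_j xi 0 j * partial j (partial i f) x).
Proof.
move=> oU Ux fU; have [_ _ d2] := fU _ Ux.
apply: is_derive_direction => [|j]; last by have [] := d2 i j.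
have : \forall y \near x, U y by exact: open_nbhs_nbhs.
by apply: filterS => y /fU[_ _ d] j; have [] := d i j.
Qed.

Lemma near_line U x xi : open U -> U x -> \forall t \near (0 : R), U (x + t *: xi).
Proof.
move=> oU Ux.
have : x + t *: xi @[t --> (0 : R)] --> x.
  rewrite -[X in _ --> X]addr0 -[X in _ + X](scale0r xi).
  by apply: cvgD; [exact: cvg_cst|apply: cvgZr_tmp; exact: cvg_id].
by apply; exact: open_nbhs_nbhs.
Qed.

Lemma quadratic_formB xi (A B : 'I_3 -> 'I_3 -> R) :
  \sum_i xi 0 i * (\sum_j xi 0 j * A i j - \sum_j xi 0 j * B i j) =
  \sum_i \sum_j xi 0 i * xi 0 j * A i j - \sum_i \sum_j xi 0 i * xi 0 j * B i j.
Proof.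
rewrite -sumrB; apply: eq_bigr => i _; rewrite mulrBr !mulr_sumr.
by congr (_ - _); apply: eq_bigr => j _; rewrite mulrA.
Qed.

(** Apply the one-variable first and second derivative tests to u - v along each line through x. *)
Lemma C2_touching U u v x : open U -> U x -> C2 U u -> C2 U v ->
  (forall y, U y -> u y - v y <= u x - v x) ->
  (forall i, partial i u x = partial i v x) /\
  forall xi, \sum_i \sum_j xi 0 i * xi 0 j * partial j (partial i u) x <=
             \sum_i \sum_j xi 0 i * xi 0 j * partial j (partial i v) x.
Proof.
move=> oU Ux uU vU uv.
pose phi xi (t : R) := u (x + t *: xi) - v (x + t *: xi).
pose dphi xi (t : R) :=
  \sum_i xi 0 i * (partial i u (x + t *: xi) - partial i v (x + t *: xi)).
have phiE xi : \forall t \near (0 : R), is_derive (t : R) 1 (phi xi) (dphi xi t).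
  apply: filterS (near_line xi oU Ux) => t Ut.
  have du := (is_derive_line u x xi t _).1 (C2_is_derive xi oU Ut uU).
  have dv := (is_derive_line v x xi t _).1 (C2_is_derive xi oU Ut vU).
  have := is_deriveB du dv; rewrite -sumrB.
  by under eq_bigr do rewrite -mulrBr.
have phimax xi : \forall t \near (0 : R), phi xi t <= phi xi 0.
  apply: filterS (near_line xi oU Ux) => t Ut.
  by rewrite /phi scale0r addr0; exact: uv.
split=> [i|xi].
  have := is_derive_at_max (phiE (delta_mx 0 i)) (phimax (delta_mx 0 i)).
  rewrite /dphi scale0r addr0 (bigD1 i)//= big1 => [|j ji].
    by rewrite mxE !eqxx mul1r addr0 => /eqP; rewrite subr_eq0 => /eqP.
  by rewrite mxE (negPf ji) andbF mul0r.
rewrite -subr_le0; apply: (second_derivative_le0_at_max (phiE xi) _ (phimax xi)).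
have ddp (i : 'I_3) : is_derive (0 : R) 1
    (fun t => xi 0 i * (partial i u (x + t *: xi) - partial i v (x + t *: xi)))
    (xi 0 i * (\sum_j xi 0 j * partial j (partial i u) x
      - \sum_j xi 0 j * partial j (partial i v) x)).
  have x0 : U (x + 0 *: xi) by rewrite scale0r addr0.
  have du := (is_derive_line _ x xi 0 _).1 (C2_is_derive_partial xi i oU x0 uU).
  have dv := (is_derive_line _ x xi 0 _).1 (C2_is_derive_partial xi i oU x0 vU).
  have := is_deriveZ (xi 0 i) (is_deriveB du dv).
  by rewrite scale0r addr0.
have := is_derive_sum ddp.
rewrite (_ : \sum_i _ = dphi xi); last by apply/funext => t; rewrite fct_sumE.
move=> /is_derive_eq; apply.
exact: quadratic_formB.
Qed.

(** The hypothesis controls f only along points of [Om], whereas the extreme value theorem needs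
    continuity along boundary points too. A point y of the closure near x is compared with x through
    a point z of [Om] close to y. *)
Lemma continuous_closure Om f :
  (forall x, closure Om x -> f @ within Om (nbhs x) --> f x) ->
  {within closure Om, continuous f}.
Proof.
move=> cf; apply/subspace_continuousP => x Omx.
apply/cvgrPdist_le => e e0; have e20 : 0 < e / 2 by rewrite divr_gt0.
have /cvgrPdist_le/(_ _ e20) := cf _ Omx.
(* [nbhs_interior] turns the bound near x into one valid near every y close to x, which leaves room
   to choose z near y. *)
rewrite !near_withinE => /nbhs_interior; apply: filterS => y Uy Omy.
have /cvgrPdist_le/(_ _ e20) := cf _ Omy.
move=> H; have Fy : ProperFilter (within Om (nbhs y)) by exact: within_nbhs_proper.
have U1 : within Om (nbhs y) [set z | `|f x - f z| <= e / 2] by exact: Uy.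
have [z [zy zx]] := filter_ex (filterI H U1).
rewrite (splitr e) (le_trans (ler_distD (f z) _ _))// lerD//.
by rewrite distrC.
Qed.

(** The limits of the partial derivatives at each point of the closure give local bounds;
    compactness, in its near-covering form, makes them uniform. *)
Lemma bounded_partials Om u : compact (closure Om) -> C2_closure Om u ->
  exists2 M : R, 0 < M & forall x i, Om x -> `|partial i u x| <= M.
Proof.
move=> /compact_near_coveringP cOm [_ uOm].
have : \forall M \near +oo,
    closure Om `<=` (fun x => Om x -> forall i, `|partial i u x| <= M).
  apply: cOm => x Omx.
  have [_ /(_ _)/cvg_ex-dl _] := uOm _ Omx.
  have {dl} bd i : \forall y \near x & M \near +oo, Om y -> `|partial i u y| <= M.
    have [l /cvgrPdist_le/(_ _ ltr01)] := dl i.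
    rewrite near_withinE => Hl.
    exists ([set y | Om y -> `|l - partial i u y| <= 1], [set M | `|l| + 1 <= M]).
      split; first exact: Hl.
      by apply: nbhs_pinfty_ge; exact: num_real.
    move=> [y M] /= [Hy lM] Omy; apply: le_trans lM.
    have -> : partial i u y = l - (l - partial i u y) by rewrite opprB addrC subrK.
    by rewrite (le_trans (ler_normB _ _))// lerD2l; exact: Hy.
  apply: (filterS _ (filter_forall _ bd)) => -[y M]/= H Omy i; exact: H.
move=> H; have [M [HM M0]] := filter_ex (filterI H (nbhs_pinfty_gt (num_real 0))).
by exists M => // x i Omx; apply: HM => //; exact: subset_closure.
Qed.

End C2Calculus.

(** * Nonexistence on large balls *)

Section Nonexistence.
Variable R : realType.
Implicit Types (r : R) (u : 'rV[R]_3 -> R) (x : 'rV[R]_3).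

Definition quadratic_form (H : 'M[R]_3) (xi : 'rV[R]_3) : R :=
  \sum_i \sum_j xi 0 i * xi 0 j * H i j.

(** The cross products of p with the basis vectors; their outer products sum to |p|^2 I - p p^T. *)
Definition cross_axis (p : 'rV[R]_3) : seq 'rV[R]_3 :=
  [:: \row_i [:: 0; p 0 2%:R; - p 0 1]`_i; \row_i [:: - p 0 2%:R; 0; p 0 0]`_i;
      \row_i [:: p 0 1; - p 0 0; 0]`_i].

(* For p = Du the matrix W^2 g^{-1} = (1 + |p|^2) I - p p^T equals I + C^T C,
   where C is the cross product with p. *)
Lemma trace_cross_product (p : 'rV[R]_3) (W : R) (H : 'M[R]_3) :
  0 < W -> W ^+ 2 = 1 + dot p p ->
  \sum_i \sum_k ((i == k)%:R - p 0 i * p 0 k / W ^+ 2) * (H k i / W) =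
  (W ^+ 3)^-1 * (\sum_i H i i + \sum_(xi <- cross_axis p) quadratic_form H xi).
Proof.
move=> W0; rewrite dotE => W2.
rewrite /quadratic_form !big_cons big_nil !big_ord_recl !big_ord0 !mxE /=.
have o0 : ord0 = 0 :> 'I_3 by exact/val_inj.
have o1 : lift ord0 ord0 = 1 :> 'I_3 by exact/val_inj.
have o2 : lift ord0 (lift ord0 ord0) = 2%:R :> 'I_3 by exact/val_inj.
rewrite !o2 !o1 !o0.
move: (p 0 0) (p 0 1) (p 0 2%:R) W2 => a b c W2.
move: (H 0 0) (H 0 1) (H 0 2%:R) (H 1 0) (H 1 1) (H 1 2%:R)
  (H 2%:R 0) (H 2%:R 1) (H 2%:R 2%:R) => h1 h2 h3 h4 h5 h6 h7 h8 h9.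
apply/eqP; rewrite -subr_eq0.
have Wn0 : W != 0 by rewrite gt_eqF.
(* The two sides differ by this multiple of the relation [W2], so [field] can treat W as a free
   variable. *)
pose K := (W ^+ 2 - (1 + (a * a + b * b + c * c))) * (h1 + h5 + h9) / W ^+ 3.
have K0 : K = 0 by rewrite /K W2 subrr !mul0r.
by apply/eqP; rewrite -[RHS]K0 /K; field.
Qed.

Definition trace_value (p : 'rV[R]_3) (H : 'M[R]_3) : R :=
  (Num.sqrt (1 + dot p p) ^+ 3)^-1 *
  (\sum_i H i i + \sum_(xi <- cross_axis p) quadratic_form H xi).

Lemma trace_shape (Om : set 'rV[R]_3) u x :
  \tr (Defs.shape Om u x) = trace_value (Du Om u x) (D2u Om u x).
Proof.
have W2_gt0 (p : 'rV[R]_3) : 0 < 1 + dot p p by rewrite ltr_wpDr// dot_ge0.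
have gW0 : 0 < gW Om u x by rewrite /gW sqrtr_gt0.
have gW2 : gW Om u x ^+ 2 = 1 + dot (Du Om u x) (Du Om u x).
  by rewrite /gW sqr_sqrtr// ltW.
rewrite /trace_value -/(gW Om u x) -(trace_cross_product (D2u Om u x) gW0 gW2).
apply: eq_bigr => i _; rewrite mxE; apply: eq_bigr => k _.
by rewrite [g_inv _ _ _ i k]mxE [second_form _ _ _ k i]mxE.
Qed.

(** Ellipticity of the mean curvature operator: [trace_value] is a positive multiple of a sum of
    values of the quadratic form of H, the diagonal entries being its values at the basis
    vectors. *)
Lemma trace_value_le (p : 'rV[R]_3) (H K : 'M[R]_3) :
  (forall xi, quadratic_form H xi <= quadratic_form K xi) ->
  trace_value p H <= trace_value p K.
Proof.
move=> HK; rewrite ler_wpM2l ?invr_ge0 ?exprn_ge0 ?sqrtr_ge0//.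
have diagE (A : 'M[R]_3) : \sum_i A i i = \sum_i quadratic_form A (delta_mx 0 i).
  apply: eq_bigr => i _; rewrite /quadratic_form (bigD1 i)//= (bigD1 i)//=.
  rewrite !mxE !eqxx !mul1r big1 ?big1 ?addr0// => j ji.
    by rewrite big1// => k _; rewrite !mxE (negPf ji) andbF !mul0r.
  by rewrite !mxE (negPf ji) andbF mulr0 mul0r.
by rewrite !diagE lerD// ler_sum.
Qed.

(** Compare the two functions at x and at t x. Along this segment u varies by at most 3 M r (1 - t).
    The height of the sphere drops from k to h with k^2 - h^2 = (1 - t)(1 + t) r^2, so k - h is at
    least (1 - t) r^2 / (k + h), which is larger once k + h <= 3 h and 9 M h < r. Hence t x would
    beat x. *)
Lemma cap_boundary_slope r u (M : R) x (q : R) : 0 < r -> 0 < M ->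
  C2_closure (eball r) u -> (forall y i, eball r y -> `|partial i u y| <= M) ->
  enorm x = r -> q = r ^+ 2 + (r / (9 * M + 1)) ^+ 2 ->
  ~ (forall y, eball r y -> u y - cap q 0 y <= u x - cap q 0 x).
Proof.
move=> r0 M0 [uC2 uC] uM xr qE xmax.
(* The 9 is 3 * 3: one factor from the three coordinates in x . Du, the other from k + h <= 3 h. The
   +1 makes 9 M h < r strict and gives h <= r. *)
set h := r / (9 * M + 1) in qE.
have M1 : 0 < 9 * M + 1 by rewrite ltr_wpDr// mulr_gt0.
have h0 : 0 < h by rewrite divr_gt0.
have hr : 9 * M * h < r.
  by rewrite /h mulrA ltr_pdivrMr// mulrC ltr_pM2l// ltrDl.
have hr1 : h <= r.
  by rewrite ler_pdivrMr// ler_peMr ?(ltW r0)// lerDr mulr_ge0// ltW.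
(* This t satisfies (1 - t) r^2 = h^2 / 2, close enough to 1 to force k <= 2 h. *)
clearbody h; pose t := 1 - h ^+ 2 / (2 * r ^+ 2).
have r2 : 0 < 2 * r ^+ 2 by rewrite mulr_gt0// exprn_gt0.
have tE : 1 - t = h ^+ 2 / (2 * r ^+ 2) by rewrite /t opprB addrC subrK.
have t1 : t < 1 by rewrite -subr_gt0 tE divr_gt0// exprn_gt0.
have t0 : 0 < t.
  rewrite subr_gt0 ltr_pdivrMr// mul1r mulr_natl mulr2n.
  apply: (le_lt_trans (y := r ^+ 2)); first by rewrite ler_pXn2r// nnegrE ltW.
  by rewrite ltrDl exprn_gt0.
have dx : dot x x = r ^+ 2 by rewrite -xr sqr_enorm.
have inB (s : R) : 0 <= s -> s < 1 -> eball r (s *: x).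
  by move=> s0 s1; rewrite /eball/= enormZ ger0_norm// xr gtr_pMl.
pose phi (s : R) := u (s *: x).
pose dphi (s : R) := \sum_i x 0 i * partial i u (s *: x).
have oB := @open_eball R r.
have dphiE (s : R) : 0 <= s -> s < 1 -> is_derive s 1 phi (dphi s).
  move=> s0 s1; have Bs : eball r (0 + s *: x) by rewrite add0r; exact: inB.
  have := (is_derive_line u 0 x s _).1 (C2_is_derive x oB Bs uC2).
  rewrite add0r (_ : (fun s => u (0 + s *: x)) = phi)//.
  by apply/funext => s'; rewrite add0r.
have cphi (s : R) : 0 <= s -> s < 1 -> {for s, continuous phi}.
  move=> s0 s1; apply/differentiable_continuous/derivable1_diffP.
  by have [] := dphiE s s0 s1.
have uL : u x - u (t *: x) <= 3 * M * r * (1 - t).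
  have [s||c ct] := @MVT R phi dphi t 1 t1.
  - by rewrite in_itv/= => /andP[ts s1]; apply: dphiE; rewrite // ltW// (lt_trans t0).
  - apply/continuous_within_itvP => //; split.
    + by move=> s; rewrite in_itv/= => /andP[ts s1]; apply: cphi; rewrite // ltW// (lt_trans t0).
    + by apply: cvg_at_right_filter; exact: cphi (ltW t0) t1.
    (* At s = 1 the point x lies on the boundary, and continuity of [phi] from the left is what
       [C2_closure] provides. *)
    + have Bx : closure (eball r) x by rewrite closure_eball//= xr.
      have [ux _ _] := uC _ Bx.
      rewrite {2}/phi scale1r; apply: cvg_trans ux => A /=.
      rewrite /within/= => BA.
      have : s *: x @[s --> (1 : R)] --> x.
        by rewrite -[X in _ --> X]scale1r; apply: cvgZr_tmp; exact: cvg_id.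
      move=> /(_ _ BA) /= xA.
      suff : \forall s \near (1 : R)^'-, A (phi s) by [].
      near=> s; have : eball r (s *: x).
        have s0 : 0 < s by near: s; apply: nbhs_left_gt; exact: ltr01.
        by apply: inB; [exact: ltW|near: s; exact: nbhs_left_lt].
      by near: s; apply: cvg_within; exact: xA.
  rewrite {1 2}/phi scale1r => ->; rewrite ler_wpM2r ?subr_ge0 ?(ltW t1)//.
  move: ct; rewrite in_itv/= => /andP[tc c1].
  have Bc : eball r (c *: x) by apply: inB => //; rewrite ltW// (lt_trans t0).
  rewrite (le_trans (ler_norm _))// (le_trans (ler_norm_sum _ _ _))//.
  rewrite (@le_trans _ _ (\sum_(i < 3) r * M))//.
    apply: ler_sum => i _; rewrite normrM ler_pM// -?xr; first exact: normr_coord_le.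
    exact: uM.
  by rewrite sumr_const card_ord -[leLHS]mulr_natl [r * M]mulrC mulrA.
set k := Num.sqrt (q - dot (t *: x) (t *: x)).
have Hx : cap q 0 x = - h.
  rewrite /cap sub0r dx qE addrAC subrr add0r sqrtr_sqr ger0_norm//; exact: ltW.
have := xmax _ (inB t (ltW t0) t1); rewrite Hx.
have -> : cap q 0 (t *: x) = - k by rewrite /cap sub0r.
rewrite !opprK => uk.
have k2 : k ^+ 2 = h ^+ 2 + (1 - t) * (1 + t) * r ^+ 2.
  rewrite sqr_sqrtr.
    by rewrite dotZl dotZr dx qE; ring.
  rewrite subr_ge0 dotZl dotZr dx qE mulrA -expr2.
  rewrite (@le_trans _ _ (r ^+ 2))// ?lerDl ?sqr_ge0//.
  by rewrite ler_piMl ?sqr_ge0// expr_le1// ?ltW.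
have k0 : 0 <= k by exact: sqrtr_ge0.
have k2h : k <= 2 * h.
  have h20 : 0 <= 2 * h by rewrite mulr_ge0// ltW.
  rewrite -(@ler_pXn2r _ 2)//.
  have tr : (1 - t) * r ^+ 2 = h ^+ 2 / 2.
    by rewrite tE; field; rewrite gt_eqF.
  rewrite k2 mulrAC tr; have := sqr_ge0 h; nra.
have kh : k - h <= 3 * M * r * (1 - t) by move: uk uL; lra.
have t1' : 0 < 1 - t by rewrite subr_gt0.
have : (1 - t) * ((1 + t) * r ^+ 2) <= (1 - t) * (3 * M * r * (k + h)).
  have -> : (1 - t) * ((1 + t) * r ^+ 2) = (k - h) * (k + h).
    by rewrite -subr_sqr k2; ring.
  rewrite [leRHS](_ : _ = 3 * M * r * (1 - t) * (k + h)); last by ring.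
  by rewrite ler_wpM2r// addr_ge0// ltW.
rewrite ler_pM2l// => le1.
have le2 : 3 * M * r * (k + h) <= r * (9 * M * h).
  rewrite [leRHS](_ : _ = 3 * M * r * (2 * h + h)); last by ring.
  by rewrite ler_wpM2l ?lerD2r// !mulr_ge0// ltW.
have : r * (9 * M * h) < r * r by rewrite ltr_pM2l.
apply/negP; rewrite -leNgt (le_trans _ le2)// (le_trans _ le1)//.
by rewrite -expr2 ler_peMl ?sqr_ge0// lerDl ltW.
Unshelve. all: by end_near. Qed.

Theorem no_curvature_solution r u : Num.sqrt 3 <= r ->
  ~ curvature_solution (eball r) u.
Proof.
move=> r3 [uC2 uadm u1].
have r0 : 0 < r by rewrite (lt_le_trans _ r3)// sqrtr_gt0.
have [M M0 uM] := bounded_partials (compact_closure_eball r0) uC2.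
pose q := r ^+ 2 + (r / (9 * M + 1)) ^+ 2.
have M1 : 0 < 9 * M + 1 by rewrite ltr_wpDr// mulr_gt0.
have qr : r ^+ 2 < q by rewrite ltrDl exprn_gt0// divr_gt0.
have ballq : closure (eball r) `<=` [set x | dot x x < q].
  by move=> x; rewrite closure_eball//= (enorm_le x (ltW r0)) => /le_lt_trans; apply.
have oB := @open_eball R r.
pose w x := u x - cap q 0 x.
have cw : {within closure (eball r), continuous w}.
  apply: continuous_closure => x Bx; have [_ /(_ _ Bx)[ux _ _]] := uC2.
  have [_ /(_ _ Bx)[vx _ _]] := C2_closure_sub ballq (@C2_cap R q 0).
  exact: (cvgB ux vx).
have B0 : closure (eball r) !=set0.
  by exists 0; apply: subset_closure; rewrite /eball/= enorm0.
have [x] := EVT_max_rV B0 (compact_closure_eball r0) cw.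
rewrite inE => Bx xmax.
have {}xmax y : eball r y -> w y <= w x.
  by move=> By; apply: xmax; rewrite inE; exact: subset_closure.
have : enorm x <= r by move: Bx; rewrite closure_eball.
rewrite le_eqVlt => /orP[/eqP xr|xr].
  exact: (cap_boundary_slope r0 M0 uC2 uM xr erefl).
have uI : C2 (eball r) u by case: uC2.
have vI : C2 (eball r) (cap q 0).
  by move=> y By; apply: C2_cap; apply: ballq; exact: subset_closure.
have [d1 d2] := C2_touching oB xr uI vI xmax.
have DE : Du (eball r) u x = Du (eball r) (cap q 0) x.
  rewrite (DuE Bx xr uI) (DuE Bx xr vI).
  by apply/rowP => i; rewrite !mxE.
have quadE f xi : C2 (eball r) f -> quadratic_form (D2u (eball r) f x) xi =
    \sum_i \sum_j xi 0 i * xi 0 j * partial j (partial i f) x.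
  move=> wI; apply: eq_bigr => i _; apply: eq_bigr => j _.
  by rewrite (D2uE i j Bx xr wI).
have le_eq (a b a' b' : R) : a = a' -> b = b' -> a' <= b' -> a <= b by move=> -> ->.
have HK xi : quadratic_form (D2u (eball r) u x) xi <=
    quadratic_form (D2u (eball r) (cap q 0) x) xi.
  exact: le_eq (quadE u xi uI) (quadE _ xi vI) (d2 xi).
(* As the gradients agree, both traces are [trace_value] at the same p, and only the Hessians
   differ. *)
have : \tr (Defs.shape (eball r) u x) <= \tr (Defs.shape (eball r) (cap q 0) x).
  apply: le_eq (trace_shape _ u x) _ (trace_value_le (Du (eball r) u x) HK).
  exact: etrans (trace_shape _ _ x) (congr1 (fun p => trace_value p _) (esym DE)).
have tru := sigma2_eigenvalues_trace (u1 _ xr) (uadm _ Bx).1.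
move=> /(le_trans tru); rewrite (shape_cap 0 ballq Bx) mxtrace_scalar.
apply/negP; rewrite -ltNge.
have s3 : 0 < Num.sqrt (3 : R) by rewrite sqrtr_gt0.
have q0 : 0 < q by rewrite (lt_trans _ qr)// exprn_gt0.
(* Strict even for r = sqrt 3, because q > r ^ 2. *)
have : Num.sqrt 3 < Num.sqrt q.
  rewrite ltr_sqrt// (le_lt_trans _ qr)//.
  by rewrite -[leLHS](sqr_sqrtr (ler0n R 3)) ler_pXn2r// nnegrE ltW.
move=> sq; rewrite -[ltLHS]mulr_natl ltr_pdivrMr ?sqrtr_gt0//.
by rewrite -{1}(sqr_sqrtr (ler0n R 3)) expr2 ltr_pM2l.
Qed.

End Nonexistence.

(** * The normal field of a ball *)

Section BallNormal.
Variable R : realType.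
Implicit Types (r : R) (x y xi : 'rV[R]_3).

Definition sphere_fun r y : R := dot y y - r ^+ 2.

Lemma is_derive_sphere_fun r x xi : is_derive x xi (sphere_fun r) (2 * dot x xi).
Proof.
have dd := is_derive_dot x xi.
have : is_derive x xi ((fun y : 'rV[R]_3 => dot y y) - cst (r ^+ 2)) (2 * dot x xi).
  by apply: is_derive_eq; rewrite subr0.
by [].
Qed.

Lemma partial_sphere_fun r (i : 'I_3) : partial i (sphere_fun r) = (fun y => 2 * y 0 i).
Proof.
apply/funext => y; rewrite /partial; have [_ ->] := is_derive_sphere_fun r y (delta_mx 0 i).
by rewrite dot_delta.
Qed.

Lemma gradient_sphere_fun r y : gradient (sphere_fun r) y = 2 *: y.
Proof. by apply/rowP => i; rewrite !mxE partial_sphere_fun. Qed.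

Lemma C2_sphere_fun r : C2 setT (sphere_fun r).
Proof.
move=> x _; split.
- exact: (cvgB (@continuous_dot R x) (cvg_cst _)).
- move=> i; split; first by have [] := is_derive_sphere_fun r x (delta_mx 0 i).
  rewrite partial_sphere_fun.
  exact: (cvgM (cvg_cst _) (@coord_continuous R 1 3 0 i x)).
- move=> i j; rewrite partial_sphere_fun.
  have d y : is_derive y (delta_mx 0 j) (fun y : 'rV[R]_3 => 2 * y 0 i)
      (2 * (delta_mx 0 j : 'rV[R]_3) 0 i).
    exact: (is_deriveZ 2 (is_derive_coord y (delta_mx 0 j) i)).
  split; first by have [] := d x.
  have -> : partial j (fun y : 'rV[R]_3 => 2 * y 0 i) =
      (fun=> 2 * (delta_mx 0 j : 'rV[R]_3) 0 i).
    by apply/funext => y; have [_ <-] := d y.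
  exact: cst_continuous.
Qed.

Lemma defining_sphere_fun r x : 0 < r -> enorm x = r ->
  defining_function (eball r) x (sphere_fun r).
Proof.
move=> r0 xr; split.
  rewrite gradient_sphere_fun scaler_eq0 (pnatr_eq0 R 2)/=.
  by apply/eqP => x0; move: xr r0; rewrite x0 enorm0 => <-; rewrite ltxx.
exists setT; first by split; [exact: openT|].
split; first exact: C2_sphere_fun.
by move=> y _; rewrite /eball/= (enorm_lt y (ltW r0)) /sphere_fun subr_lt0.
Qed.

(** For small h > 0 the point x + h xi is in the ball, where rho < 0, while rho x >= 0; so rho
    cannot increase along xi. *)
Lemma defining_function_inward r x rho xi : 0 < r -> enorm x = r ->
  defining_function (eball r) x rho -> dot x xi < 0 -> dot xi (gradient rho x) <= 0.
Proof.
move=> r0 xr [_ [U [oU Ux] [rhoU Urho]]] xxi; rewrite leNgt; apply/negP => D0.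
have [d dE] : is_derive x xi rho (dot xi (gradient rho x)).
  rewrite (_ : dot xi (gradient rho x) = \sum_i xi 0 i * partial i rho x).
    exact: C2_is_derive oU Ux rhoU.
  by apply: eq_bigr => i _; rewrite mxE.
have L : h^-1 *: (rho (h *: xi + x) - rho x) @[h --> (0:R)^'] --> dot xi (gradient rho x).
  by rewrite -dE; exact: d.
have rhox : 0 <= rho x.
  rewrite leNgt; apply/negP => /(Urho x Ux); rewrite /eball/= xr ltxx; exact.
have /cvgr_gt/(_ _ D0) := L; rewrite near_withinE => pos.
have dx : dot x x = r ^+ 2 by rewrite -xr sqr_enorm.
have D1 : 0 < dot xi xi + 1 by rewrite ltr_wpDl// dot_ge0.
near (0 : R)^'+ => h.
have h0 : 0 < h by near: h; exact: nbhs_right_gt.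
have : 0 < h^-1 *: (rho (h *: xi + x) - rho x).
  have h0' : h != 0 by rewrite gt_eqF.
  by move: h0'; near: h; apply: cvg_within; exact: pos.
rewrite [X in 0 < X](_ : _ = h^-1 * (rho (h *: xi + x) - rho x))//.
rewrite pmulr_rgt0 ?invr_gt0// subr_gt0 => /(le_lt_trans rhox).
apply/negP; rewrite -leNgt ltW//.
have Uh : U (h *: xi + x).
  by rewrite addrC; near: h; apply: cvg_within; exact: (near_line xi oU Ux).
apply/(Urho _ Uh); rewrite /eball/= (enorm_lt _ (ltW r0)).
rewrite !dotDl !dotDr !dotZl !dotZr dx (dotC xi x) -subr_gt0.
rewrite [ltRHS](_ : _ = h * (- (2 * dot x xi) - h * dot xi xi)); last by ring.
rewrite mulr_gt0// subr_gt0.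
apply: (@le_lt_trans _ _ (h * (dot xi xi + 1))).
  by rewrite ler_wpM2l ?lerDl// ltW.
rewrite -ltr_pdivlMr//; near: h; apply: nbhs_right_lt.
by rewrite divr_gt0// oppr_gt0 pmulr_rlt0.
Unshelve. all: by end_near. Qed.

(** [outer_normal] may pick any defining function, so all their gradients must be located. Testing
    the inward inequality on z - d x, where z is the tangential part of the gradient, gives |z|^2 <=
    d (x . g) for every d > 0, hence z = 0. *)
Lemma gradient_defining_function r x rho : 0 < r -> enorm x = r ->
  defining_function (eball r) x rho -> exists2 l : R, 0 < l & gradient rho x = l *: x.
Proof.
move=> r0 xr Drho; have inward := defining_function_inward r0 xr Drho.
have [g0 _] := Drho; set g := gradient rho x in inward g0 *.
have dx : dot x x = r ^+ 2 by rewrite -xr sqr_enorm.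
have r2 : 0 < r ^+ 2 by rewrite exprn_gt0.
pose l := dot g x / r ^+ 2; pose z := g - l *: x.
have zx : dot z x = 0.
  rewrite /z dotDl -scaleNr dotZl dx /l mulNr mulfVK ?subrr// gt_eqF//.
have gE : g = l *: x + z by rewrite /z addrC subrK.
have zz : dot z z = 0.
  have zg : dot z g = dot z z by rewrite {1}gE dotDr dotZr zx mulr0 add0r.
  have bound (d : R) : 0 < d -> dot z z <= d * dot x g.
    move=> d0; have := inward (z - d *: x).
    rewrite dotDr -scaleNr dotZr dx dotC zx add0r mulNr oppr_lt0 mulr_gt0// => /(_ isT).
    by rewrite dotDl dotZl zg mulNr subr_le0.
  apply/eqP; rewrite eq_le dot_ge0 andbT.
  have [xg|xg] := leP (dot x g) 0.
    by have := bound 1 ltr01; rewrite mul1r => /le_trans; apply.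
  rewrite leNgt; apply/negP => zz0.
  (* This d turns the bound into |z|^2 <= |z|^2 / 2. *)
  have := bound (dot z z / (2 * dot x g)) _.
  rewrite divr_gt0// ?mulr_gt0// => /(_ isT).
  have xg0 : dot x g != 0 by rewrite gt_eqF.
  rewrite [leRHS](_ : _ = dot z z / 2); last by field.
  by move: zz0; lra.
have {zz} z0 : z = 0 by apply/eqP; rewrite -dot_eq0 zz.
move: gE; rewrite z0 addr0 => gE; exists l => //.
have l0 : 0 <= l.
  have := inward (- 1 *: x); rewrite dotZr dx mulN1r oppr_lt0 r2 => /(_ isT).
  by rewrite dotZl gE dotZr dx mulN1r oppr_le0 pmulr_lge0.
rewrite lt_def l0 andbT; apply: contraNneq g0 => l00.
by rewrite gE l00 scale0r.
Qed.

Lemma outer_normal_eball r x : 0 < r -> enorm x = r ->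
  outer_normal (eball r) x = r^-1 *: x.
Proof.
move=> r0 xr; rewrite /outer_normal; case: xgetP => [nu _ /= [rho Drho ->]|].
  have [l l0 gE] := gradient_defining_function r0 xr Drho.
  rewrite /unit_normal_field gE enormZ xr gtr0_norm// scalerA invfM mulrAC mulVf ?mul1r//.
  by rewrite gt_eqF.
move=> /(_ (unit_normal_field (sphere_fun r) x)); case.
by exists (sphere_fun r) => //; exact: defining_sphere_fun.
Qed.

Lemma unit_normal_sphere_fun r y :
  unit_normal_field (sphere_fun r) y = (enorm y)^-1 *: y.
Proof.
rewrite /unit_normal_field gradient_sphere_fun enormZ ger0_norm// scalerA invfM.
by rewrite mulrAC mulVf ?mul1r// pnatr_eq0.
Qed.

Lemma is_derive_enorm x xi : x != 0 -> is_derive x xi (@enorm R) (dot x xi / enorm x).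
Proof.
move=> x0.
have dx0 : 0 < dot x x by rewrite lt_def dot_ge0 dot_eq0 x0.
have e0 : enorm x != 0 by rewrite gt_eqF// sqrtr_gt0.
have := is_derive_comp_direction (is_derive_dot x xi) (is_derive1_sqrt dx0).
move=> /is_derive_eq; apply; rewrite -[Num.sqrt _]/(enorm x); field.
exact: e0.
Qed.

(** In a tangential direction the factor 1 / |y| of the normal field y / |y| has zero derivative,
    which leaves xi / r. *)
Lemma boundary_form_sphere_fun r x xi : 0 < r -> enorm x = r -> dot xi x = 0 ->
  boundary_form (sphere_fun r) x xi xi = r^-1 * dot xi xi.
Proof.
move=> r0 xr xix.
have x0 : x != 0.
  by apply/eqP => x0; move: xr r0; rewrite x0 enorm0 => <-; rewrite ltxx.
have e0 : enorm x != 0 by rewrite xr gt_eqF.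
have de := is_derive_enorm xi x0.
have dE (i : 'I_1) (j : 'I_3) : is_derive x xi
    (fun y => unit_normal_field (sphere_fun r) y i j) (r^-1 * xi 0 j).
  have [d1 d2] := de; have dc := is_derive_coord x xi j.
  have dV : is_derive x xi (fun y => (@enorm R y)^-1) 0.
    apply: DeriveDef; first exact: derivableV.
    by rewrite (deriveV e0 d1) d2 dotC xix mul0r scaler0.
  have := is_deriveM dV dc.
  rewrite (_ : (fun y => (enorm y)^-1) * _ =
      (fun y => unit_normal_field (sphere_fun r) y i j)).
    move=> /is_derive_eq; apply; by rewrite xr scaler0 addr0.
  by apply/funext => y; rewrite unit_normal_sphere_fun ord1 !mxE.
rewrite /boundary_form derive_mx; last first.
  by apply/derivable_mxP => i j; have [] := dE i j.
rewrite (_ : \matrix_(i, j) _ = r^-1 *: xi) ?dotZl//.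
by apply/matrixP => i j; rewrite !mxE ord1; have [_ ->] := dE 0 j.
Qed.

Lemma uniformly_convex_eball r : 0 < r -> uniformly_convex_domain (eball r : set 'rV[R]_3).
Proof.
move=> r0; split.
- by exists 0; rewrite /eball/= enorm0.
- exact: open_eball.
- exact: connected_eball.
- exact: bounded_eball.
exists r^-1; first by rewrite invr_gt0.
move=> x; rewrite boundary_eball//= => xr.
exists (sphere_fun r); first exact: defining_sphere_fun.
move=> xi; rewrite gradient_sphere_fun dotZr => /eqP.
rewrite mulf_eq0 pnatr_eq0/= => /eqP xix.
by rewrite boundary_form_sphere_fun.
Qed.

End BallNormal.

(** * Solutions on small balls *)

Section SphericalCaps.
Variable R : realType.
Implicit Types (r a c : R) (x y : 'rV[R]_3).

Lemma sqr_lt3 r : 0 < r < Num.sqrt 3 -> r ^+ 2 < 3.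
Proof.
move=> /andP[r0 r3]; rewrite -[ltRHS](sqr_sqrtr (ler0n R 3)).
by rewrite ltr_pXn2r// nnegrE ?sqrtr_ge0// ltW.
Qed.

Lemma closure_eball_cap r : 0 < r < Num.sqrt 3 ->
  closure (eball r) `<=` [set x : 'rV[R]_3 | dot x x < 3].
Proof.
move=> r3 x; have /andP[r0 _] := r3.
by rewrite closure_eball//= (enorm_le x (ltW r0)) => /le_lt_trans; apply; exact: sqr_lt3.
Qed.

Lemma sphere_capE c : (fun x => sphere_cap x + c) = cap (3 : R) c.
Proof.
by apply/funext => x; rewrite /sphere_cap /cap sqr_enorm addrC.
Qed.

Lemma robin_capE r a :
  robin_cap r a = cap 3 (Num.sqrt (3 - r ^+ 2) - r / (a * Num.sqrt (3 - r ^+ 2))).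
Proof. by rewrite -sphere_capE; apply/funext => x; rewrite /robin_cap addrA. Qed.

(** The radius sqrt 3 is the one for which three equal curvatures give 3 (1 / sqrt 3)^2 = 1. *)
Lemma curvature_solution_cap r c : 0 < r < Num.sqrt 3 ->
  curvature_solution (eball r) (cap 3 c).
Proof.
move=> r3; have sub := closure_eball_cap r3; have s3 : 0 < Num.sqrt (3 : R) by rewrite sqrtr_gt0.
split.
- exact: C2_closure_sub sub (@C2_cap R 3 c).
- move=> x Bx; rewrite (curvatures_cap c sub Bx) /Gamma2/= !sigma_const_mx.
  by rewrite expr1 !pmulrn_lgt0 ?exprn_gt0 ?invr_gt0.
- move=> x /subset_closure Bx; rewrite (curvatures_cap c sub Bx) sigma_const_mx.
  rewrite exprVn sqr_sqrtr// -[LHS]mulr_natr mulVf// pnatr_eq0//.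
Qed.

Lemma normal_derivative_cap r c x : 0 < r < Num.sqrt 3 -> enorm x = r ->
  normal_derivative (eball r) (cap 3 c) x = r / Num.sqrt (3 - r ^+ 2).
Proof.
move=> r3 xr; have sub := closure_eball_cap r3; have /andP[r0 _] := r3.
have Bx : closure (eball r) x by rewrite closure_eball//= xr.
rewrite /normal_derivative (Du_cap c sub Bx) outer_normal_eball//.
rewrite dotZl dotZr -sqr_enorm xr /height -sqr_enorm xr mulrC.
by rewrite expr2 mulKf ?gt_eqF.
Qed.

Lemma neumann_solution_cap r c : 0 < r < Num.sqrt 3 ->
  neumann_solution (eball r) (r / Num.sqrt (3 - r ^+ 2)) (cap 3 c).
Proof.
move=> r3; split; first exact: curvature_solution_cap.
have /andP[r0 _] := r3.
by move=> x; rewrite boundary_eball//= => xr; rewrite normal_derivative_cap.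
Qed.

Lemma robin_solution_cap r a : 0 < r < Num.sqrt 3 -> 0 < a ->
  robin_solution (eball r) a (robin_cap r a).
Proof.
move=> r3 a0; rewrite robin_capE; split; first exact: curvature_solution_cap.
have /andP[r0 _] := r3.
move=> x; rewrite boundary_eball//= => xr; rewrite normal_derivative_cap//.
have h0 : 0 < Num.sqrt (3 - r ^+ 2) by rewrite sqrtr_gt0 subr_gt0 sqr_lt3.
rewrite /cap -sqr_enorm xr; field.
by rewrite !gt_eqF.
Qed.

(** The points (x, a) and (y, b), with a and b their heights, lie on a sphere of radius sqrt 3 in
    R^4, and a chord of a sphere is strictly inside it: the squared gap is t (1 - t) times the
    squared length of the chord. *)
Lemma strictly_convex_cap r c : 0 < r < Num.sqrt 3 ->
  strictly_convex_on (closure (eball r)) (cap 3 c).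
Proof.
move=> r3 x y t Bx By xy /andP[t0 t1].
have x3 := closure_eball_cap r3 Bx; have y3 := closure_eball_cap r3 By.
have {}t1 : 0 < 1 - t by rewrite subr_gt0.
have hx := height_gt0 x3; have hy := height_gt0 y3.
have hx2 := sqr_height (ltW x3); have hy2 := sqr_height (ltW y3).
rewrite /cap -/(height 3 x) -/(height 3 y).
set a := height 3 x in hx hx2 *; set b := height 3 y in hy hy2 *.
suff : t * a + (1 - t) * b < height 3 (t *: x + (1 - t) *: y) by rewrite /height; lra.
have ab : 0 <= t * a + (1 - t) * b by rewrite addr_ge0// mulr_ge0// ltW.
have key : (t * a + (1 - t) * b) ^+ 2 <
    3 - dot (t *: x + (1 - t) *: y) (t *: x + (1 - t) *: y).
  rewrite !dotDl !dotDr !dotZl !dotZr (dotC y x).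
  have d0 : 0 < dot (x - y) (x - y).
    by rewrite lt_def dot_ge0 dot_eq0 subr_eq0 xy.
  have dE : dot (x - y) (x - y) = dot x x - 2 * dot x y + dot y y.
    by rewrite -[- y]scaleN1r !dotDl !dotDr !dotZl !dotZr (dotC y x); ring.
  have xyE : dot x y = 3 - (a ^+ 2 + b ^+ 2 + dot (x - y) (x - y)) / 2.
    by rewrite dE hx2 hy2; field.
  have -> : dot x x = 3 - a ^+ 2 by rewrite hx2; ring.
  have -> : dot y y = 3 - b ^+ 2 by rewrite hy2; ring.
  rewrite xyE -subr_gt0.
  rewrite [ltRHS](_ : _ = t * (1 - t) * (dot (x - y) (x - y) + (a - b) ^+ 2)); last by field.
  by rewrite !mulr_gt0// ltr_wpDr// sqr_ge0.
by rewrite -(ger0_norm ab) -sqrtr_sqr ltr_sqrt// (le_lt_trans (sqr_ge0 _) key).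
Qed.

Lemma cvg_slope_cap :
  r / Num.sqrt (3 - r ^+ 2) @[r --> (Num.sqrt 3 : R)^'-] --> +oo.
Proof.
have s3 : 0 < Num.sqrt (3 : R) by rewrite sqrtr_gt0.
have s31 : 1 < Num.sqrt (3 : R) by rewrite -[ltLHS]sqrtr1 ltr_sqrt// ltr1n.
have s32 : Num.sqrt (3 : R) <= 2.
  rewrite -(@ler_pXn2r _ 2)// ?nnegrE ?sqrtr_ge0// sqr_sqrtr//.
  by rewrite -natrX ler_nat.
have s3E := sqr_sqrtr (ler0n R 3).
apply/cvgryPge => A; pose B : R := `|A| + 1.
have B0 : 0 < B by rewrite ltr_wpDl.
near=> r.
have r1 : 1 < r by near: r; exact: nbhs_left_gt.
have r3 : r < Num.sqrt 3 by near: r; exact: nbhs_left_lt.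
(* Together with sqrt 3 + r <= 4, this margin yields 3 - r ^ 2 <= B ^- 2, hence A sqrt (3 - r ^ 2)
   <= 1 < r. *)
have rB : Num.sqrt 3 - B ^- 2 / 4 < r.
  near: r; apply: nbhs_left_gt; rewrite ltrBlDr ltrDl divr_gt0// invr_gt0.
  exact: exprn_gt0.
have h0 : 0 < 3 - r ^+ 2.
  by rewrite subr_gt0 sqr_lt3// r3 (lt_trans ltr01).
rewrite ler_pdivlMr ?sqrtr_gt0//.
have hB : Num.sqrt (3 - r ^+ 2) <= B^-1.
  have Bi0 : 0 <= B^-1 by rewrite invr_ge0 ltW.
  rewrite -(ger0_norm Bi0) -sqrtr_sqr ler_wsqrtr// exprVn.
  rewrite -{1}s3E subr_sqr.
  apply: (@le_trans _ _ (B ^- 2 / 4 * 4)); last by rewrite mulfVK// pnatr_eq0.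
  rewrite ler_pM// ?subr_ge0 ?(ltW r3)//; first by rewrite addr_ge0// ltW// (lt_trans ltr01).
    by move: rB; lra.
  by move: r3 s32; lra.
apply: (@le_trans _ _ (B * B^-1)).
  apply: (@le_trans _ _ (`|A| * Num.sqrt (3 - r ^+ 2))).
    by rewrite ler_wpM2r ?sqrtr_ge0 ?ler_norm.
  by rewrite ler_pM ?sqrtr_ge0// lerDl.
by rewrite mulfV ?gt_eqF// ltW.
Unshelve. all: by end_near. Qed.

End SphericalCaps.

(** * The volume of a ball *)

(** The outer product measure is by definition the integral of the measures of the sections; an
    explicit formula f for these reduces it to an iterated integral by Tonelli. *)
Lemma product_measure3E (d1 d2 d3 : measure_display) (T1 : measurableType d1)
    (T2 : measurableType d2) (T3 : measurableType d3) (R : realType)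
    (m1 : {sigma_finite_measure set T1 -> \bar R})
    (m2 : {sigma_finite_measure set T2 -> \bar R})
    (m3 : {sigma_finite_measure set T3 -> \bar R}) (X : set (T1 * T2 * T3))
    (f : T1 * T2 -> \bar R) :
  measurable_fun setT f -> (forall p, 0 <= f p)%E ->
  (forall p, m3 (xsection X p) = f p) ->
  ((m1 \x m2) \x m3)%E X = (\int[m1]_x \int[m2]_y f (x, y))%E.
Proof.
move=> mf f0 Xf; rewrite -(fubini_tonelli1 _ mf f0).
rewrite {1}/product_measure1 (_ : m3 \o xsection X = f)//.
by apply/funext => p; exact: Xf.
Qed.

Section BallVolume.
Variable R : realType.
Implicit Types (r d : R).
Local Notation T := (measurableTypeR R).
Local Notation mu := (@lebesgue_measure R).

(** True for every real d because [Num.sqrt] is 0 on negative numbers, so the iterated integral can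
    run over the whole line. *)
Lemma lebesgue_measure_sqr_lt d :
  mu [set y : R | y ^+ 2 < d] = (2 * Num.sqrt d)%:E.
Proof.
have [d0|d0] := leP d 0.
  rewrite (_ : [set y | _] = set0) ?measure0.
    by rewrite ler0_sqrtr// mulr0.
  apply/seteqP; split => // y /= yd.
  by have := lt_le_trans yd d0; rewrite ltNge sqr_ge0.
have s0 : 0 < Num.sqrt d by rewrite sqrtr_gt0.
rewrite (_ : [set y | _] = `](- Num.sqrt d), (Num.sqrt d)[%classic).
  rewrite lebesgue_measure_itv/= lte_fin gt0_cp// -EFinB; congr EFin; ring.
apply/seteqP; split => y /=; rewrite in_itv/= -ltr_norml -[`|y|]sqrtr_sqr ltr_sqrt//.
Qed.

(** The area of a disc, by the substitution x = r sin t on [- pi / 2, pi / 2], where cos t >= 0 lets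
    the square root be taken. *)
Lemma integral_sqrt_sqrB r : 0 < r ->
  (\int[mu]_(x in `[(- r)%R, r]) (2 * Num.sqrt (r ^+ 2 - x ^+ 2))%:E)%E = (pi * r ^+ 2)%:E.
Proof.
move=> r0.
pose F (t : R) := r * sin t.
have dF (t : R) : is_derive t 1 F (r * cos t).
  rewrite (_ : F = r \*: @sin R); last by apply/funext.
  by apply: is_derive_eq.
have F'E : F^`()%classic = (fun t => r * cos t).
  by apply/funext => t; rewrite derive1E; have [_ ->] := dF t.
have FN : F (- (pi / 2)) = - r by rewrite /F sinN sin_pihalf mulrN1.
have FP : F (pi / 2) = r by rewrite /F sin_pihalf mulr1.
have cF : continuous F.
  by move=> t; apply: cvgMr; exact: continuous_sin.
have cF' : continuous (fun t : R => r * cos t).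
  by move=> t; apply: cvgMr; exact: continuous_cos.
have cG : continuous (fun x : R => 2 * Num.sqrt (r ^+ 2 - x ^+ 2)).
  move=> x.
  have c1 : (fun x : R => r ^+ 2 - x ^+ 2) @ x --> r ^+ 2 - x ^+ 2.
    by apply: cvgB; [exact: cvg_cst|exact: exprn_continuous].
  have c2 := continuous_cvg _ (@sqrt_continuous R _) c1.
  exact: (cvgM (cvg_cst _) (c2 _)).
have pi20 : 0 < pi / 2 :> R by rewrite divr_gt0// pi_gt0.
rewrite -FN -[X in `[_, X]]FP.
rewrite integration_by_substitution_increasing; last 7 first.
- by rewrite ge0_cp// ltW.
- move=> x y xI yI xy; rewrite /F ltr_pM2l//.
  by rewrite ltr_sin.
- by move=> t _; rewrite F'E; exact: cF'.
- by rewrite F'E; apply/cvg_ex; eexists; apply: cvg_at_right_filter; exact: cF'.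
- by rewrite F'E; apply/cvg_ex; eexists; apply: cvg_at_left_filter; exact: cF'.
- split; first by move=> t _; have [] := dF t.
    by apply: cvg_at_right_filter; exact: cF.
  by apply: cvg_at_left_filter; exact: cF.
- exact: continuous_subspaceT.
pose P (t : R) := r ^+ 2 * (t + sin t * cos t).
have dP (t : R) : is_derive t 1 P (2 * r ^+ 2 * cos t ^+ 2).
  rewrite (_ : P = r ^+ 2 \*: (@id R + @sin R * @cos R)); last by apply/funext.
  have := is_deriveZ (r ^+ 2) (is_deriveD (is_derive_id t (1 : R))
    (is_deriveM (is_derive_sin t) (is_derive_cos t))).
  move=> /is_derive_eq; apply.
  rewrite [LHS](_ : _ = r ^+ 2 * (1 + (sin t * - sin t + cos t * cos t)))//.
  rewrite mulrN -!expr2 sin2cos2; ring.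
have cP : continuous P.
  move=> t; apply/differentiable_continuous/derivable1_diffP.
  by have [] := dP t.
transitivity (\int[mu]_(t in `[(- (pi / 2))%R, (pi / 2)%R])
    (2 * r ^+ 2 * cos t ^+ 2)%:E)%E.
  apply: eq_integral => t; rewrite inE/= in_itv/= => /andP[t0 t1]; congr EFin.
  rewrite F'E /=.
  rewrite [LHS](_ : _ = 2 * Num.sqrt (r ^+ 2 - F t ^+ 2) * (r * cos t))//.
  have -> : r ^+ 2 - F t ^+ 2 = (r * cos t) ^+ 2.
    by rewrite /F !exprMn sin2cos2; ring.
  rewrite sqrtr_sqr ger0_norm ?mulr_ge0 ?(ltW r0) ?cos_ge0_pihalf ?t0//.
  ring.
rewrite (@continuous_FTC2 _ _ P).
- by rewrite /P sinN cosN sin_pihalf cos_pihalf -EFinB; congr EFin; field.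
- by rewrite gt0_cp.
- apply: continuous_subspaceT => t.
  exact: (cvgM (cvg_cst _) (cvgM (@continuous_cos R t) (@continuous_cos R t))).
- split; first by move=> t _; have [] := dP t.
    by apply: cvg_at_right_filter; exact: cP.
  by apply: cvg_at_left_filter; exact: cP.
- by move=> t _; rewrite derive1E; have [_ ->] := dP t.
Qed.


(** The slices of the ball are discs of squared radius d, empty for d <= 0; [Num.max] covers both
    cases. *)
Lemma integral_sqrt d :
  (\int[mu]_y (2 * Num.sqrt (d - y ^+ 2))%:E)%E = (pi * Num.max d 0)%:E.
Proof.
have [d0|d0] := leP d 0.
  rewrite mulr0 (_ : (fun x : R => _) = cst 0%E) ?integral0//.
  apply/funext => x; rewrite ler0_sqrtr ?mulr0//.
  by rewrite subr_le0 (le_trans d0)// sqr_ge0.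
rewrite -{2}(sqr_sqrtr (ltW d0)) -integral_sqrt_sqrB ?sqrtr_gt0//.
rewrite [RHS]integral_mkcond; apply: eq_integral => x _.
rewrite patchE; case: ifPn => [_|]; first by rewrite sqr_sqrtr// ltW.
rewrite notin_setE/= in_itv/= -ler_norml => /negP; rewrite -ltNge => xd.
rewrite ler0_sqrtr ?mulr0// subr_le0 -[leRHS]real_normK ?num_real//.
by rewrite -[leLHS](sqr_sqrtr (ltW d0)) ler_pXn2r ?nnegrE ?sqrtr_ge0// ltW.
Qed.

Lemma measurable_sqrt_sqrB d : measurable_fun setT
  (fun p : T * T => (2 * Num.sqrt (d - p.1 ^+ 2 - p.2 ^+ 2))%:E).
Proof.
apply/measurable_EFinP; apply: measurable_funM; first exact: measurable_cst.
have ms : measurable_fun setT (@Num.sqrt R).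
  by apply: continuous_measurable_fun; exact: sqrt_continuous.
apply: (measurableT_comp ms); apply: measurable_funB; [apply: measurable_funB|].
- exact: measurable_cst.
- by apply: measurable_funX; exact: measurable_fst.
- by apply: measurable_funX; exact: measurable_snd.
Qed.

Lemma volume_eball r : 0 < r ->
  volume (eball r : set 'rV[R]_3) = (4 / 3 * pi * r ^+ 3)%:E.
Proof.
move=> r0; rewrite /volume.
pose f (p : T * T) : \bar R := (2 * Num.sqrt (r ^+ 2 - p.1 ^+ 2 - p.2 ^+ 2))%:E.
rewrite (@product_measure3E _ _ _ T T T R mu mu mu _ f); last 3 first.
- exact: measurable_sqrt_sqrB.
- by move=> p; rewrite lee_fin mulr_ge0// sqrtr_ge0.
- move=> p; rewrite /f -lebesgue_measure_sqr_lt; congr (mu _).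
  apply/seteqP; split => y; rewrite /xsection/= inE/= /eball/= (enorm_lt _ (ltW r0));
    by rewrite dotE !mxE/= !expr2; lra.
transitivity (\int[mu]_z (pi * Num.max (r ^+ 2 - z ^+ 2) 0)%:E)%E.
  by apply: eq_integral => z _; rewrite /f/= integral_sqrt.
transitivity (\int[mu]_(z in `[(- r)%R, r]) (pi * (r ^+ 2 - z ^+ 2))%:E)%E.
  rewrite [RHS]integral_mkcond; apply: eq_integral => z _.
  rewrite patchE; case: ifPn => [|].
    rewrite inE/= in_itv/= -ler_norml => zr.
    by rewrite max_l// subr_ge0 -[leLHS]real_normK ?num_real// ler_pXn2r ?nnegrE// ltW.
  rewrite notin_setE/= in_itv/= -ler_norml => /negP; rewrite -ltNge => zr.
  rewrite max_r ?mulr0// subr_le0 -[leRHS]real_normK ?num_real//.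
  by rewrite ler_pXn2r ?nnegrE ?(ltW r0)// ltW.
pose P (z : R) := pi * (r ^+ 2 * z - z ^+ 3 / 3).
have dP (z : R) : is_derive z 1 P (pi * (r ^+ 2 - z ^+ 2)).
  have D := is_deriveZ (pi : R) (is_deriveB (is_deriveZ (r ^+ 2) (is_derive_id z (1 : R)))
    (is_deriveZ (3^-1 : R) (is_deriveX 3 (is_derive_id z (1 : R))))).
  rewrite (_ : P = pi \*: (r ^+ 2 \*: @id R - 3^-1 \*: (@id R ^+ 3))); last first.
    by apply/funext => y; rewrite /P /= [y ^+ 3 / 3]mulrC.
  move: D => /is_derive_eq; apply.
  rewrite [LHS](_ : _ = pi * (r ^+ 2 * 1 - 3^-1 * ((3%:R * z ^+ 2) * 1)))//.
  by field.
have cP : continuous P.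
  move=> z; apply/differentiable_continuous/derivable1_diffP.
  by have [] := dP z.
rewrite (@continuous_FTC2 _ _ P).
- by rewrite /P -EFinB; congr EFin; field.
- by rewrite gt0_cp.
- apply: continuous_subspaceT => z.
  have c1 : (fun z : R => r ^+ 2 - z ^+ 2) @ z --> r ^+ 2 - z ^+ 2.
    by apply: cvgB; [exact: cvg_cst|exact: exprn_continuous].
  exact: (cvgM (cvg_cst _) c1).
- split; first by move=> z _; have [] := dP z.
    by apply: cvg_at_right_filter; exact: cP.
  by apply: cvg_at_left_filter; exact: cP.
- by move=> z _; rewrite derive1E; have [_ ->] := dP z.
Qed.

End BallVolume.

(** * Optimality of the volume bound *)

Section Optimality.
Variable R : realType.

Lemma no_robin_solution (r a : R) : Num.sqrt 3 <= r -> ~ robin_solvable a (eball r).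
Proof. by move=> r3 [u [/no_curvature_solution]]; exact. Qed.

Lemma no_neumann_solution (r : R) : Num.sqrt 3 <= r -> ~ neumann_solvable (eball r).
Proof. by move=> r3 [l [u [/no_curvature_solution]]]; exact. Qed.

Lemma volume_eball_sqrt3 :
  volume (eball (Num.sqrt 3 : R)) = (4 * pi * Num.sqrt 3)%:E.
Proof.
rewrite volume_eball ?sqrtr_gt0//; congr EFin.
by rewrite (exprS _ 2) sqr_sqrtr//; field.
Qed.

(** A ball of the prescribed volume v is uniformly convex, and for v >= 4 pi sqrt 3 its radius is at
    least sqrt 3. Keeping S abstract serves both boundary value problems. *)
Lemma optimal_endpoint_sqrt3 (S : set (set 'rV[R]_3)) :
  (forall r : R, Num.sqrt 3 <= r -> ~ S (eball r)) ->
  optimal_endpoint S (4 * pi * Num.sqrt 3).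
Proof.
move=> noS; have s3 : 0 < Num.sqrt (3 : R) by rewrite sqrtr_gt0.
have pi0 : 0 < pi :> R by exact: pi_gt0.
have opt P : volume_guarantees P S ->
    forall v : R, 0 < v -> P v%:E -> v < 4 * pi * Num.sqrt 3.
  move=> PS v v0 Pv; rewrite ltNge; apply/negP => vc.
  pose w := v / (4 / 3 * pi).
  have c0 : 0 < 4 / 3 * pi :> R by rewrite mulr_gt0// divr_gt0.
  have w0 : 0 < w by rewrite divr_gt0.
  pose r := w `^ 3^-1.
  have r0 : 0 < r by exact: powR_gt0.
  have r3 : r ^+ 3 = w.
    by rewrite -powR_mulrn ?powR_ge0// -powRrM mulVf ?pnatr_eq0// powRr1// ltW.
  have vE : 4 / 3 * pi * r ^+ 3 = v by rewrite r3 /w mulrC divfK// gt_eqF.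
  have sr : Num.sqrt 3 <= r.
    rewrite -(@ler_pXn2r _ 3) ?nnegrE ?(ltW s3) ?(ltW r0)//.
    rewrite r3 ler_pdivlMr// (exprS _ 2) sqr_sqrtr//.
    by apply: le_trans vc; rewrite le_eqVlt; apply/orP; left; apply/eqP; field.
  apply: (noS r sr); apply: PS; first exact: uniformly_convex_eball.
  by rewrite volume_eball// vE.
split=> // c' c'S; rewrite leNgt; apply/negP => cc'.
have c0 : 0 < 4 * pi * Num.sqrt 3 :> R by rewrite !mulr_gt0.
(* A condition |Om| < c' with c' above the endpoint would admit the endpoint itself as a volume,
   against the first claim. *)
by have := opt _ c'S _ c0; rewrite /= lte_fin ltxx => /(_ cc').
Qed.

End Optimality.

Theorem mainTheorem4 (R : realType) :
  (* (i) *)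
  (forall r : R, Num.sqrt 3 <= r ->
     (forall a : R, 0 < a <= 1 ->
        ~ exists u : 'rV[R]_3 -> R, robin_solution (eball r) a u) /\
     (forall lambda : R,
        ~ exists u : 'rV[R]_3 -> R, neumann_solution (eball r) lambda u))
  /\
  (* (ii) *)
  (forall r a : R, 0 < r < Num.sqrt 3 -> 0 < a <= 1 ->
     [/\ robin_solution (eball r) a (robin_cap r a),
         strictly_convex_on (closure (eball r)) (robin_cap r a)
       & forall x, closure (eball r) x ->
           forall i, 0 < curvatures (eball r) (robin_cap r a) x 0 i])
  /\
  (forall r c : R, 0 < r < Num.sqrt 3 ->
     neumann_solution (eball r) (r / Num.sqrt (3 - r ^+ 2))
       (fun x => sphere_cap x + c))
  /\
  (r / Num.sqrt (3 - r ^+ 2) @[r --> (Num.sqrt 3 : R)^'-] --> +oo)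
  /\
  (* (iii) *)
  volume (eball (Num.sqrt 3 : R)) = (4 * pi * Num.sqrt 3)%:E
  /\
  (forall a : R, 0 < a <= 1 ->
     optimal_endpoint (robin_solvable a) (4 * pi * Num.sqrt 3))
  /\
  optimal_endpoint (@neumann_solvable R) (4 * pi * Num.sqrt 3).
Proof.
split.
  move=> r r3; split=> [a _|lambda]; first exact: no_robin_solution.
  by move=> [u sol]; apply: (no_neumann_solution r3); exists lambda, u.
split.
  move=> r a r3 /andP[a0 _]; split; first exact: robin_solution_cap.
    by rewrite robin_capE; exact: strictly_convex_cap.
  move=> x Bx i; rewrite robin_capE (curvatures_cap _ (closure_eball_cap r3) Bx) mxE.
  by rewrite invr_gt0 sqrtr_gt0.
split; first by move=> r c r3; rewrite sphere_capE; exact: neumann_solution_cap.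
split; first exact: cvg_slope_cap.
split; first exact: volume_eball_sqrt3.
split; first by move=> a _; apply: optimal_endpoint_sqrt3 => r; exact: no_robin_solution.
by apply: optimal_endpoint_sqrt3 => r; exact: no_neumann_solution.
Qed.
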